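(* Let $(\mathcal{M},g)$ be a four-dimensional spacetime with Lorentzian metric $g$, let $f$ be an analytic function, and let $G_{\mu\nu}=R_{\mu\nu}-\frac12 g_{\mu\nu}R$ be the Einstein tensor of $g$. Let $$\Delta G_{\mu\nu}=\bigl(G_{\mu\nu}+g_{\mu\nu}\Box-\nabla_{\mu}\nabla_{\nu}\bigr)\bigl[f+\Box^{-1}[Rf']\bigr]+\Bigl[\delta_{\mu}^{(\sigma}\delta_{\nu}^{\lambda)}-\tfrac{1}{2}g_{\mu\nu}g^{\sigma\lambda}\Bigr]\partial_{\sigma}\bigl(\Box^{-1}[Rf']\bigr)\,\partial_{\lambda}\bigl(\Box^{-1}R\bigr),$$ where $f=f(\Box^{-1}R)$ and $f'$ is the derivative of $f$ evaluated at $\Box^{-1}R$. Then the covariant 4-divergence of the sum vanishes: $$\nabla^{\mu}\bigl(G_{\mu\nu}+\Delta G_{\mu\nu}\bigr)=0 .$$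
   Context: $\nabla$ is the Levi-Civita connection of $g$, $R_{\mu\nu}$ and $R$ are the Ricci tensor and Ricci scalar, and $\Box=\nabla^{\mu}\nabla_{\mu}$, which on scalars equals $\frac{1}{\sqrt{-g}}\partial_{\sigma}(\sqrt{-g}\,g^{\sigma\lambda}\partial_{\lambda})$. Round brackets on indices denote symmetrization with weight $\frac12$: $\delta_{\mu}^{(\sigma}\delta_{\nu}^{\lambda)}=\frac12(\delta_{\mu}^{\sigma}\delta_{\nu}^{\lambda}+\delta_{\mu}^{\lambda}\delta_{\nu}^{\sigma})$. The curvature convention is $[\nabla_{\mu},\nabla_{\nu}]A^{\gamma}=R^{\gamma}{}_{\lambda\mu\nu}A^{\lambda}$. The operator $\Box^{-1}$ is the integral operator $(\Box^{-1}p)(x)=\int_{\Omega}d^4x'\sqrt{-g(x')}\,G(x,x')\,p(x')$ over a region $\Omega$ of spacetime (identified with an open subset of $\mathbb{R}^4$ via a chart), where $G(x,x')$ is the retarded Green function of $\Box$, i.e. $\sqrt{-g(x)}\,\Box_xG(x,x')=\delta^4(x-x')$ and $G(x,x')=0$ for all $t<t'$. It is the inverse of $\Box$: $\Box\Box^{-1}=\Box^{-1}\Box=\mathbb{1}$. The functions $\Box^{-1}R$ and $\Box^{-1}[Rf']$ are obtained by applying $\Box^{-1}$ to the scalar functions $R$ and $R\,f'(\Box^{-1}R)$. In $\Delta G_{\mu\nu}$, the term $(G_{\mu\nu}+g_{\mu\nu}\Box-\nabla_\mu\nabla_\nu)[\,\cdot\,]$ means multiplication by $G_{\mu\nu}$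 plus the action of the differential operators on the function in brackets. *)

(* Defs.v *)
From HB Require Import structures.
From mathcomp Require Import all_boot all_order all_algebra.
From mathcomp Require Import all_classical all_reals all_analysis.

Set Implicit Arguments.
Unset Strict Implicit.
Unset Printing Implicit Defensive.

Import Order.TTheory GRing.Theory Num.Theory.
Import numFieldNormedType.Exports.

Local Open Scope classical_set_scope.
Local Open Scope ring_scope.

(* Everything is written in a chart: points are coordinate vectors x^0, ..., x^3
   (x^0 = t is time), fields are given by their components as functions on the
   whole of R^4, and only their values on an open set Omega are meaningful. *)

Definition scalar_field (R : realType) : Type := 'rV[R]_4 -> R.
Definition tensor2 (R : realType) : Type := 'rV[R]_4 -> 'M[R]_4.

Definition pd (R : realType) (i : 'I_4) (h : scalar_field R) : scalar_field R :=
  fun x => 'D_(delta_mx ord0 i : 'rV[R]_4) h x.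

Definition pds (R : realType) (s : seq 'I_4) (h : scalar_field R)
    : scalar_field R :=
  foldr (@pd R) h s.

(* C^oo on an open set Omega: a function is C^oo iff all its iterated partial
   derivatives exist and are (Frechet) differentiable. *)
Definition smooth_on (R : realType) (Omega : set 'rV[R]_4)
    (h : scalar_field R) : Prop :=
  forall (s : seq 'I_4) (x : 'rV[R]_4), Omega x -> differentiable (pds s h) x.

Definition analytic_on (R : realType) (U : set R) (f : R -> R) : Prop :=
  forall a, U a -> exists c : nat -> R,
    \forall x \near a, series (fun n => c n * (x - a) ^+ n) @ \oo --> f x.

Definition minkowski (R : realType) : 'M[R]_4 :=
  diag_mx (\row_i (if i == ord0 then -1 else 1)).

(* Signature (-,+,+,+) or (+,-,-,-): no sign convention is preferred. *)
Definition lorentzian (R : realType) (m : 'M[R]_4) : Prop :=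
  m^T = m /\
  exists2 P : 'M[R]_4, P \in unitmx &
    P *m m *m P^T = minkowski R \/ P *m m *m P^T = - minkowski R.

Definition lorentzian_metric (R : realType) (Omega : set 'rV[R]_4)
    (g : tensor2 R) : Prop :=
  (forall i j, smooth_on Omega (fun x => g x i j)) /\
  (forall x, Omega x -> lorentzian (g x)).

Definition ginv (R : realType) (g : tensor2 R) : tensor2 R :=
  fun x => invmx (g x).

Definition sqrtg (R : realType) (g : tensor2 R) : scalar_field R :=
  fun x => Num.sqrt (- \det (g x)).

(* Gamma^a_{bc} *)
Definition christoffel (R : realType) (g : tensor2 R) (a b c : 'I_4) :
    scalar_field R :=
  fun x => 2^-1 * \sum_d ginv g x a d *
    (pd b (fun y => g y d c) x + pd c (fun y => g y d b) x
     - pd d (fun y => g y b c) x).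

(* riemann g c l m n = R^c_{l m n}, with the sign and index order for which
   [nabla_m, nabla_n] A^c = R^c_{l m n} A^l. *)
Definition riemann (R : realType) (g : tensor2 R) (c l m n : 'I_4) :
    scalar_field R :=
  fun x => pd m (christoffel g c n l) x - pd n (christoffel g c m l) x
    + \sum_k (christoffel g c m k x * christoffel g k n l x
              - christoffel g c n k x * christoffel g k m l x).

Definition ricci (R : realType) (g : tensor2 R) : tensor2 R :=
  fun x => \matrix_(m, n) \sum_l riemann g l m l n x.

Definition ricci_scalar (R : realType) (g : tensor2 R) : scalar_field R :=
  fun x => \sum_m \sum_n ginv g x m n * ricci g x m n.

Definition einstein (R : realType) (g : tensor2 R) : tensor2 R :=
  fun x => ricci g x - (2^-1 * ricci_scalar g x) *: g x.

(* nabla_m w_n *)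
Definition nabla_covector (R : realType) (g : tensor2 R)
    (w : 'I_4 -> scalar_field R) (m n : 'I_4) : scalar_field R :=
  fun x => pd m (w n) x - \sum_l christoffel g l m n x * w l x.

(* nabla_m T_{ab} *)
Definition nabla_tensor2 (R : realType) (g : tensor2 R) (T : tensor2 R)
    (m a b : 'I_4) : scalar_field R :=
  fun x => pd m (fun y => T y a b) x
    - \sum_l christoffel g l m a x * T x l b
    - \sum_l christoffel g l m b x * T x a l.

(* nabla_m nabla_n h *)
Definition hessian (R : realType) (g : tensor2 R) (h : scalar_field R)
    : tensor2 R :=
  fun x => \matrix_(m, n) nabla_covector g (fun l => pd l h) m n x.

(* nabla^m nabla_m h *)
Definition box (R : realType) (g : tensor2 R) (h : scalar_field R)
    : scalar_field R :=
  fun x => \sum_m \sum_n ginv g x m n * hessian g h x m n.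

(* nabla^m T_{mn} *)
Definition divergence (R : realType) (g : tensor2 R) (T : tensor2 R)
    (n : 'I_4) : scalar_field R :=
  fun x => \sum_l \sum_m ginv g x l m * nabla_tensor2 g T l m n x.

Definition test_function (R : realType) (Omega : set 'rV[R]_4)
    (h : scalar_field R) : Prop :=
  smooth_on Omega h /\
  exists K : set 'rV[R]_4,
    [/\ compact K, K `<=` Omega & forall x, ~ K x -> h x = 0].

(* T : C_c^oo(Omega) -> R is linear, and continuous in the sense of the usual
   estimate on each compact set; its values on other functions are junk. *)
Definition distribution (R : realType) (Omega : set 'rV[R]_4)
    (T : scalar_field R -> R) : Prop :=
  (forall (a : R) (h k : scalar_field R),
     test_function Omega h -> test_function Omega k ->
     T (fun x => a * h x + k x) = a * T h + T k) /\
  (forall K : set 'rV[R]_4, compact K -> K `<=` Omega ->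
     exists (N : nat) (C : R), forall (h : scalar_field R) (M : R),
       test_function Omega h -> (forall x, ~ K x -> h x = 0) ->
       (forall s x, (size s <= N)%N -> `|pds s h x| <= M) ->
       `|T h| <= C * M).

(* In four dimensions the retarded Green function is not a function but a
   distribution concentrated on (or inside) the past light cone, so G x is the
   distribution  h |-> \int_Omega d^4x' G(x, x') h(x').  The three clauses are:
   - G(x, .) is a distribution on Omega, for each x;
   - sqrt(-g(x)) box_x G(x, x') = delta^4(x - x'), integrated against h(x');
   - G(x, x') = 0 for t < t', i.e. G x vanishes on the open set {t' > t}. *)
Definition retarded_green_function (R : realType) (Omega : set 'rV[R]_4)
    (g : tensor2 R) (G : 'rV[R]_4 -> scalar_field R -> R) : Prop :=
  [/\ forall x, Omega x -> distribution Omega (G x),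
      forall h, test_function Omega h ->
        smooth_on Omega (fun x => G x h) /\
        forall x, Omega x -> sqrtg g x * box g (fun y => G y h) x = h x
    & forall x, Omega x -> forall h,
        test_function (Omega `&` [set y | x ord0 ord0 < y ord0 ord0]) h ->
        G x h = 0].

(* The filter of cut-off functions 0 <= chi <= 1 in C_c^oo(Omega) equal to 1 on
   larger and larger compact subsets of Omega. *)
Definition cutoffs (R : realType) (Omega : set 'rV[R]_4)
    : set_system (scalar_field R) :=
  [set A | exists K : set 'rV[R]_4, [/\ compact K, K `<=` Omega &
     forall chi : scalar_field R, test_function Omega chi ->
       (forall y, 0 <= chi y <= 1) -> (forall y, K y -> chi y = 1) -> A chi]].

(* \int_Omega d^4x' sqrt(-g(x')) G(x, x') chi(x') p(x') *)
Definition cutoff_integral (R : realType) (g : tensor2 R)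
    (G : 'rV[R]_4 -> scalar_field R -> R) (p : scalar_field R) (x : 'rV[R]_4)
    (chi : scalar_field R) : R :=
  G x (fun y => sqrtg g y * (chi y * p y)).

(* (box^-1 p)(x) = \int_Omega d^4x' sqrt(-g(x')) G(x, x') p(x').  As p need
   not have compact support, the pairing with the distribution G x is an improper
   integral, the limit over compact exhaustions of Omega. *)
Definition boxinv (R : realType) (Omega : set 'rV[R]_4) (g : tensor2 R)
    (G : 'rV[R]_4 -> scalar_field R -> R) (p : scalar_field R)
    : scalar_field R :=
  fun x => lim (cutoff_integral g G p x @ cutoffs Omega).

(* box^-1 : src -> fld and box : fld -> src are mutually inverse.  Two function
   spaces are needed: box has nonzero homogeneous solutions, which fld must
   exclude (e.g. by vanishing initial data), and box^-1 only makes sense on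
   sources for which the integral converges. *)
Definition inverse_of_box (R : realType) (Omega : set 'rV[R]_4) (g : tensor2 R)
    (G : 'rV[R]_4 -> scalar_field R -> R) (src fld : set (scalar_field R))
    : Prop :=
  [/\ forall p, src p -> smooth_on Omega p /\
        forall x, Omega x -> cvg (cutoff_integral g G p x @ cutoffs Omega),
      forall u, fld u -> smooth_on Omega u,
      (forall p, src p -> fld (boxinv Omega g G p)) /\
      (forall u, fld u -> src (box g u)),
      forall p, src p -> forall x, Omega x -> box g (boxinv Omega g G p) x = p x
    & forall u, fld u -> forall x, Omega x ->
        boxinv Omega g G (box g u) x = u x].

(* delta_m^(s delta_n^l) *)
Definition sym_delta (R : realType) (m n s l : 'I_4) : R :=
  2^-1 * ((m == s)%:R * (n == l)%:R + (m == l)%:R * (n == s)%:R).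

Definition Delta_einstein (R : realType) (g : tensor2 R)
    (Binv : scalar_field R -> scalar_field R) (f : R -> R) : tensor2 R :=
  let X : scalar_field R := Binv (ricci_scalar g) in
  let Y : scalar_field R :=
    Binv (fun x => ricci_scalar g x * derive1 f (X x)) in
  let h : scalar_field R := fun x => f (X x) + Y x in
  fun x => \matrix_(m, n)
    (einstein g x m n * h x + g x m n * box g h x - hessian g h x m n
     + \sum_s \sum_l
         (sym_delta R m n s l - 2^-1 * g x m n * ginv g x s l)
         * pd s Y x * pd l X x).

(* Main.v *)
(* Write X = box^-1 R, Y = box^-1 [R f'(X)] and h = f(X) + Y, so that
   box X = R, box Y = R f'(X) and d_n h = f'(X) d_n X + d_n Y on Omega.  The
   contracted Bianchi identity kills the divergence of G, and the Ricci identity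
   gives div (g box h - nabla nabla h)_n = - R_(mn) nabla^m h; hence
   div [(1 + h) G + g box h - nabla nabla h]_n = - (1/2) R d_n h.  The
   divergence of the remaining quadratic term is
   (1/2) (box X d_n Y + box Y d_n X) = (1/2) R d_n h.

   In the chart, the connection and curvature are handled as matrices
   (A_k)^a_b = Gamma^a_(k b) and F_mn = d_m A_n - d_n A_m + [A_m, A_n].  The
   differentiability of composites with f comes from termwise differentiation of
   power series, and the commutation of partial derivatives from Schwarz's
   theorem. *)

Require Import Defs.
From mathcomp Require Import all_boot all_order all_algebra.
From mathcomp Require Import all_classical all_reals all_analysis.
From mathcomp Require Import ring lra.
Import Order.TTheory GRing.Theory Num.Theory.
Import numFieldNormedType.Exports.
Local Open Scope classical_set_scope.
Local Open Scope ring_scope.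

Set Implicit Arguments.
Unset Strict Implicit.
Unset Printing Implicit Defensive.

(** * Analytic functions *)

(** Components off [Omega] are arbitrary, so identities between fields hold on the open set only.
    Derivatives see only germs, hence such an identity may still be differentiated there, and
    rewriting under a derivative goes through extensionality on [Omega]. The tensor algebra is
    separated from the calculus: it is stated for arbitrary matrices, with letters in place of
    derivatives. Matrix products do not commute, but after full expansion an entry of an ordered
    product is an atom, and only a linear cancellation is left to [ring]. A matrix carries two
    indices, so the matrix form of a covariant derivative misses the corrections of the remaining
    ones. The symmetry of $\Gamma$ in its lower indices makes these cancel in the Bianchi and Ricci
    identities. *)

Lemma cvg_pseries_diffs (R : realType) (c : nat -> R) (K x : R) :
  cvgn (pseries c K) -> `|x| < `|K| -> cvgn (pseries (pseries_diffs c) x).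
Proof.
move=> cK xK; have K0 : 0 < `|K| := le_lt_trans (normr_ge0 x) xK.
set q := `|x| / `|K|.
have q0 : 0 <= q by rewrite divr_ge0.
have q1 : q < 1 by rewrite ltr_pdivrMr // mul1r.
have [M [_ HM]] := cvg_series_bounded cK.
have {HM} cM n : `|c n * K ^+ n| <= `|M| + 1.
  by apply: HM => //; rewrite (le_lt_trans (ler_norm M)) // ltrDl.
set d := 1 - q; have d0 : 0 < d by rewrite subr_gt0.
have d0' := ltW d0.
(* The factor $n$ of the derived series is absorbed by Bernoulli's inequality, $nd\le(1+d)^n$. With
   $d=1-q$ the enlarged ratio $(1+d)q=1-d^2$ is still below 1, so a geometric series dominates. *)
pose q' := (1 + d) * q.
have q'0 : 0 <= q' by rewrite mulr_ge0 // addr_ge0 // ltW.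
have q'1 : `|q'| < 1.
  rewrite ger0_norm //; have -> : q' = 1 - d ^+ 2 by rewrite /q' /d; ring.
  by rewrite ltrBlDr ltrDl exprn_gt0.
have bern n : n%:R * d <= (1 + d) ^+ n.
  suff : 1 + n%:R * d <= (1 + d) ^+ n by apply: le_trans; rewrite lerDr.
  elim: n => [|n IH]; first by rewrite mul0r addr0.
  rewrite exprS; apply: (@le_trans _ _ ((1 + d) * (1 + n%:R * d))).
    have : 0 <= n%:R * d ^+ 2 by rewrite mulr_ge0 ?sqr_ge0.
    by rewrite -natr1; nra.
  by rewrite ler_pM2l // addr_gt0.
apply: normed_cvg.
apply: (@series_le_cvg _ _ (geometric ((`|M| + 1) / `|K| * ((1 + d) / d)) q')).
- by move=> n; exact: normr_ge0.
- move=> n; apply: geometric_ge0 => //; apply: mulr_ge0; apply: divr_ge0 => //;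
    rewrite ?(addr_ge0 _ d0') ?addr_ge0 //.
- move=> n; rewrite /= /pseries_diffs /= !normrM normrX normr_nat.
  have Kn : `|c n.+1| <= (`|M| + 1) / `|K| ^+ n.+1.
    by rewrite ler_pdivlMr ?exprn_gt0 // -normrX -normrM.
  have nb : n.+1%:R <= (1 + d) ^+ n.+1 / d by rewrite ler_pdivlMr.
  apply: (@le_trans _ _
    ((1 + d) ^+ n.+1 / d * ((`|M| + 1) / `|K| ^+ n.+1) * `|x| ^+ n)).
    by rewrite ler_wpM2r ?exprn_ge0 // ler_pM.
  rewrite le_eqVlt; apply/orP; left; apply/eqP.
  have dn : d != 0 by rewrite gt_eqF.
  have kn : `|K| != 0 by rewrite gt_eqF.
  by rewrite /q' /q !exprMn exprVn !exprS; field; rewrite kn dn expf_neq0.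
- exact: is_cvg_geometric_series.
Qed.

(** A power series is differentiated term by term inside its disc, and the derived series is the
    local expansion of $f'$. The set [U] does not shrink, so the result can be iterated. *)
Lemma analytic_on_derive (R : realType) (U : set R) (f : R -> R) :
  analytic_on U f ->
  (forall u, U u -> derivable f u 1) /\ analytic_on U (derive1 f).
Proof.
move=> hf.
suff H a : U a -> exists c : nat -> R, \forall x \near a, derivable f x 1 /\
    series (fun n => c n * (x - a) ^+ n) @ \oo --> derive1 f x.
  split=> [u Uu|u Uu]; have [c hc] := H u Uu.
    by have [] := nbhs_singleton hc.
  by exists c; apply: filterS hc => y [].
move=> /hf[c /nbhs_ballP[e /= e0 hc]]; exists (pseries_diffs c).
have ser x : `|x - a| < e -> pseries c (x - a) @ \oo --> f x.
  by move=> xe; apply: (hc x); rewrite /ball /= distrC.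
(* Nested radii: each passage to a derived series costs a strictly smaller radius, and
   [pseries_snd_diffs] needs two passages at [K3]. *)
pose K1 := e * (4 / 5); pose K2 := e * (3 / 5).
pose K3 := e * (2 / 5); pose K4 := e * (1 / 5).
have c1 : cvgn (pseries c K1).
  apply/cvg_ex; exists (f (a + K1)).
  rewrite -[K1 in pseries c K1](addKr a) addrC; apply: ser.
  by rewrite addrC addKr ger0_norm /K1; nra.
have c2 : cvgn (pseries (pseries_diffs c) K2).
  by apply: cvg_pseries_diffs c1 _; rewrite !ger0_norm /K1 /K2; nra.
have c3 : cvgn (pseries (pseries_diffs (pseries_diffs c)) K3).
  by apply: cvg_pseries_diffs c2 _; rewrite !ger0_norm /K3 /K2; nra.
have c1' : cvgn (pseries c K3).
  apply/cvg_ex; exists (f (a + K3)).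
  rewrite -[K3 in pseries c K3](addKr a) addrC; apply: ser.
  by rewrite addrC addKr ger0_norm /K3; nra.
have c2' : cvgn (pseries (pseries_diffs c) K3).
  by apply: cvg_pseries_diffs c1 _; rewrite !ger0_norm /K1 /K3; nra.
apply/nbhs_ballP; exists K4 => /=; first by rewrite /K4; nra.
move=> x; rewrite /ball /= distrC => xK.
have xe : `|x - a| < e by apply: lt_trans xK _; rewrite /K4; nra.
have xK3 : `|x - a| < `|K3|.
  by apply: lt_trans xK _; rewrite ger0_norm /K3 /K4; nra.
have D := pseries_snd_diffs c1' c2' c3 xK3.
have fD : is_derive x 1 f (limn (pseries (pseries_diffs c) (x - a))).
  (* The function differentiated is the sum of the series, which agrees with [f] near [x]. *)
  apply: (@near_eq_is_derive _ _ _ (fun y => limn (pseries c (y - a)))).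
    have : \forall y \near x, `|y - a| < e.
      have : open [set y | `|y - a| < e].
        rewrite (_ : [set _ | _] = ball a e); first exact: ball_open.
        by apply/seteqP; split => y; rewrite /ball /= distrC.
      by rewrite openE; apply.
    by apply: filterS => y ye; apply/cvg_lim => //; apply: ser.
  have S : is_derive x (1 : R) (fun y : R => y - a) 1.
    by apply: is_derive_eq; rewrite subr0.
  have dg : derivable (fun y => limn (pseries c y)) (x - a) 1.
    by apply: ex_derive.
  have dS : derivable (fun y : R => y - a) x 1 by apply: ex_derive.
  apply: DeriveDef.
    apply/derivable1_diffP.
    apply: (@differentiable_comp _ _ _ _ (fun y : R => y - a)
      (fun y => limn (pseries c y))).
      exact/derivable1_diffP.
    exact/derivable1_diffP.
  rewrite -derive1E.
  rewrite (@derive1_comp _ (fun y : R => y - a) (fun y => limn (pseries c y))) //.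
  by rewrite !derive1E !derive_val mulr1.
split; first exact: ex_derive.
rewrite derive1E derive_val; apply: cvg_pseries_diffs c1 _.
by apply: lt_trans xK _; rewrite ger0_norm /K4 /K1; nra.
Qed.

(** * Partial derivatives and smooth functions *)

(** Differentiability belongs to the germ: the first-order expansion of [h] is also one of [k], and
    uniqueness of the differential identifies its linear part. *)
Lemma near_eq_differentiable (R : realType) (V W : normedModType R)
    (h k : V -> W) (x : V) :
  {near x, h =1 k} -> differentiable h x -> differentiable k x.
Proof.
move=> hk /diff_locallyP[dc dh].
have E : k \o shift x = cst (k x) + 'd h x +o_ 0 id.
  apply/eqaddoP => _/posnumP[e].
  move/eqaddoP : dh => /(_ e%:num (gt0 e)).
  have : \forall z \near (0 : V), h (z + x) = k (z + x).
    by move: hk; rewrite (near_shift 0) subr0.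
  apply: filterS2 => z Ez; rewrite !fctE /= Ez.
  by rewrite -(nbhs_singleton hk).
apply/diff_locallyP; have D := diff_unique dc E.
by split; rewrite D.
Qed.

(** * Symmetry of mixed partial derivatives *)

Section Partial.
Variable R : realType.
Local Notation V := 'rV[R]_4.
Local Notation e_ i := (delta_mx ord0 i : V).
Implicit Types (h k : scalar_field R) (i j : 'I_4) (x y : V).

Lemma is_derive_line i h y (s : R) : differentiable h (y + s *: e_ i) ->
  is_derive s 1 (fun r : R => h (y + r *: e_ i)) (pd i h (y + s *: e_ i)).
Proof.
move=> /(@diff_derivable _ _ _ _ _ (e_ i)) D.
have E : (fun r : R => r^-1 *: (h (y + (r *: 1 + s) *: e_ i) - h (y + s *: e_ i)))
  = (fun r : R => r^-1 *: (h (r *: e_ i + (y + s *: e_ i)) - h (y + s *: e_ i))).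
  by apply/funext => r; rewrite [r *: 1]mulr1 scalerDl addrCA.
by apply: DeriveDef; [rewrite /derivable /= E | rewrite /derive /= E].
Qed.

Lemma continuous_line i h y (a b : R) :
  (forall r, r \in `[a, b] -> differentiable h (y + r *: e_ i)) ->
  {within `[a, b], continuous (fun r : R => h (y + r *: e_ i))}.
Proof.
move=> D; apply: continuous_in_subspaceT => r /set_mem rab.
apply/differentiable_continuous/derivable1_diffP.
by have /is_derive_line[] := D r rab.
Qed.

Lemma MVT_line i h y (t : R) : 0 < t ->
  (forall r, r \in `[0, t] -> differentiable h (y + r *: e_ i)) ->
  exists2 c, c \in `]0, t[ &
    h (y + t *: e_ i) - h y = pd i h (y + c *: e_ i) * t.
Proof.
move=> t0 D.
have [r rt|c ct E] := @MVT R (fun r : R => h (y + r *: e_ i))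
  (fun r => pd i h (y + r *: e_ i)) 0 t t0 _ (continuous_line D).
  by apply/is_derive_line/D/subset_itv_oo_cc.
by exists c => //; move: E; rewrite scale0r addr0 subr0.
Qed.

(** The mean value theorem is applied twice: to $h(z+te_j)-h(z)$ along $e_i$, then to $\partial_i h$
    along $e_j$. The bound on [t] keeps all points within distance [d] of [x]. *)
Lemma second_difference (d : R) i j h x (t : R) : 0 < t ->
  t * `|e_ i| + t * `|e_ j| < d ->
  (forall y, `|y - x| < d -> differentiable h y /\ differentiable (pd i h) y) ->
  exists2 p, `|p - x| < d &
    h (x + t *: e_ i + t *: e_ j) - h (x + t *: e_ i) - h (x + t *: e_ j) + h x
    = pd j (pd i h) p * t * t.
Proof.
move=> t0 td D.
have near_x (a b : R) : a \in `[0, t] -> b \in `[0, t] ->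
    `|x + a *: e_ i + b *: e_ j - x| < d.
  rewrite !in_itv /= => /andP[a0 at_] /andP[b0 bt].
  rewrite -(addrA x) [x + _]addrC addrK (le_lt_trans (ler_normD _ _)) //.
  by rewrite !normrZ !ger0_norm // (le_lt_trans _ td) // lerD // ler_wpM2r.
have tt : t \in `[0, t] by rewrite in_itv /= lexx ltW.
have t00 : 0 \in `[0, t] by rewrite in_itv /= lexx ltW.
have sw (a b : R) : x + b *: e_ j + a *: e_ i = x + a *: e_ i + b *: e_ j.
  by rewrite addrAC.
pose phi := fun z => h (z + t *: e_ j) - h z.
have Dphi1 z : differentiable h (z + t *: e_ j) ->
    differentiable (fun z => h (z + t *: e_ j)) z.
  move=> Dz; apply: (@differentiable_comp _ _ _ _ (fun z : V => z + t *: e_ j)) => //.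
have Dphi z : differentiable h (z + t *: e_ j) -> differentiable h z ->
    differentiable phi z.
  by move=> /Dphi1 D1 D2; apply: differentiableB.
have pdphi z : differentiable h (z + t *: e_ j) -> differentiable h z ->
    pd i phi z = pd i h (z + t *: e_ j) - pd i h z.
  move=> D1 D2; rewrite /pd.
  have -> : phi = (fun z => h (z + t *: e_ j)) - h by [].
  rewrite deriveB; [|by apply: diff_derivable; exact: Dphi1|exact: diff_derivable].
  congr (_ - _); rewrite /derive /=.
  by under eq_fun do rewrite -addrA.
have dom (r : R) : r \in `[0, t] ->
    differentiable h (x + r *: e_ i + t *: e_ j) /\
    differentiable h (x + r *: e_ i).
  move=> rt; split; first by have [] := D _ (near_x _ _ rt tt).
  by have [] := D _ (near_x _ _ rt t00); rewrite scale0r addr0.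
have [|c ct E] := @MVT_line i phi x t t0.
  by move=> r /dom[D1 D2]; exact: Dphi.
have ct' : c \in `[0, t] := subset_itv_oo_cc ct.
have [Dc1 Dc2] := dom c ct'.
have [|c' ct2 E'] := @MVT_line j (pd i h) (x + c *: e_ i) t t0.
  by move=> r rt; have [] := D _ (near_x _ _ ct' rt).
exists (x + c *: e_ i + c' *: e_ j).
  exact/near_x/subset_itv_oo_cc.
rewrite -E' -pdphi // -E /phi; ring.
Qed.

Lemma second_difference_eq (t A B C D P Q : R) : 0 < t ->
  A - B - C + D = P * t * t -> A - C - B + D = Q * t * t -> P = Q.
Proof.
move=> t0 E1 E2; have tn : t != 0 by rewrite gt_eqF.
by apply: (mulIf tn); apply: (mulIf tn); rewrite -E1 -E2 (addrAC A).
Qed.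

Lemma half_dist_separates (a b p : R) :
  `|a - p| < `|a - b| / 2 -> ~ `|b - p| < `|a - b| / 2.
Proof.
move=> ap bp; have := ler_distD p a b.
by rewrite leNgt (distrC p) [ltRHS]splitr ltrD.
Qed.

(* Both mixed derivatives are limits of the second difference quotient. *)
Lemma pdC i j h x :
  (\forall y \near x, [/\ differentiable h y, differentiable (pd i h) y
                        & differentiable (pd j h) y]) ->
  {for x, continuous (pd i (pd j h))} -> {for x, continuous (pd j (pd i h))} ->
  pd i (pd j h) x = pd j (pd i h) x.
Proof.
move=> /nbhs_ballP[d /= d0 D] ci cj.
apply/eqP/contraT => neq.
have e0 : 0 < `|pd i (pd j h) x - pd j (pd i h) x| / 2.
  by rewrite divr_gt0 // normr_gt0 subr_eq0.
have /cvgrPdist_lt/(_ _ e0)/nbhs_ballP[d1 /= d10 H1] := ci.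
have /cvgrPdist_lt/(_ _ e0)/nbhs_ballP[d2 /= d20 H2] := cj.
pose m := Num.min d (Num.min d1 d2).
have m0 : 0 < m by rewrite !lt_min d0 d10 d20.
pose N := `|e_ i| + `|e_ j| + 1.
have N0 : 0 < N by rewrite ltr_wpDl // addr_ge0.
pose t := m / N.
have t0 : 0 < t by rewrite divr_gt0.
have tm : t * `|e_ i| + t * `|e_ j| < m.
  by rewrite -mulrDr /t mulrAC ltr_pdivrMr // ltr_pM2l // /N ltrDl.
have Dm y : `|y - x| < m -> [/\ differentiable h y, differentiable (pd i h) y
                        & differentiable (pd j h) y].
  by rewrite lt_min => /andP[yd _]; apply: D; rewrite -ball_normE /= distrC.
have [y /Dm[]//|p pm Ep] := @second_difference m i j h x t t0 tm.
rewrite addrC in tm.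
have [y /Dm[]//|q qm Eq] := @second_difference m j i h x t t0 tm.
rewrite (addrAC x (t *: e_ j)) in Eq.
have pq := second_difference_eq t0 Ep Eq.
have /H2 bp : ball x d2 p.
  by move: pm; rewrite !lt_min -ball_normE /= distrC => /and3P[].
have /H1 aq : ball x d1 q.
  by move: qm; rewrite !lt_min -ball_normE /= distrC => /and3P[].
rewrite pq in bp.
by case: (half_dist_separates aq bp).
Qed.

(** * Closure properties of smooth functions on an open set *)

Variable Omega : set V.
Hypothesis openO : open Omega.
Local Notation smooth := (smooth_on Omega).

Lemma near_Omega x (P : V -> Prop) :
  (forall y, Omega y -> P y) -> Omega x -> \forall y \near x, P y.
Proof.
by move=> HP Ox; apply: (filterS HP); apply: open_nbhs_nbhs; split.
Qed.

Lemma pd_ext i h k x : (forall y, Omega y -> h y = k y) -> Omega x ->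
  pd i h x = pd i k x.
Proof. by move=> hk Ox; apply: near_eq_derive; exact: near_Omega. Qed.

Lemma pds_ext s h k : (forall y, Omega y -> h y = k y) ->
  forall x, Omega x -> pds s h x = pds s k x.
Proof. by move=> hk; elim: s => //= i s IH x Ox; apply: pd_ext. Qed.

(** Leibniz-type rules do not close up under induction on the word of derivatives for a single
    function, but they do for a class. Closure is asked up to equality on [Omega], where the
    derivation rules hold. *)
Lemma smooth_coind (P : scalar_field R -> Prop) :
  (forall h, P h -> (forall x, Omega x -> differentiable h x) /\
     forall i, exists2 k, P k & forall x, Omega x -> pd i h x = k x) ->
  forall h, P h -> smooth h.
Proof.
(* [foldr] applies the last index of the word first, hence the induction from the right. *)
move=> HP h Ph s; elim/last_ind: s h Ph => [|s i IH] h Ph x Ox.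
  by have [+ _] := HP h Ph; apply.
have [_ /(_ i)[k Pk hk]] := HP h Ph.
rewrite /pds -cats1 foldr_cat /= -/(pds s (pd i h)).
apply: near_eq_differentiable (IH k Pk x Ox).
by apply: near_Omega Ox => y Oy; apply: pds_ext => // z Oz; rewrite hk.
Qed.

Lemma smooth_differentiable h x : smooth h -> Omega x -> differentiable h x.
Proof. by move=> /(_ [::]); apply. Qed.

Lemma smooth_pd i h : smooth h -> smooth (pd i h).
Proof.
by move=> hs s x Ox; have := hs (rcons s i) x Ox; rewrite /pds -cats1 foldr_cat.
Qed.

Lemma smooth_ext h k : (forall x, Omega x -> h x = k x) ->
  smooth h -> smooth k.
Proof.
move=> hk sh s x Ox; apply: near_eq_differentiable (sh s x Ox).
by apply: near_Omega Ox => y; apply: pds_ext.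
Qed.

Lemma pdD_diff i h k x : differentiable h x -> differentiable k x ->
  pd i (fun y => h y + k y) x = pd i h x + pd i k x.
Proof. by move=> dh dk; rewrite /pd -deriveD //; exact: diff_derivable. Qed.

Lemma pdM_diff i h k x : differentiable h x -> differentiable k x ->
  pd i (fun y => h y * k y) x = h x * pd i k x + pd i h x * k x.
Proof.
move=> dh dk; rewrite /pd.
rewrite (@deriveM _ _ h k x); [|exact: diff_derivable..].
by rewrite [k x *: _]mulrC.
Qed.

(** Written with the factor $-1$ and a product of inverses, so that the result is built from the
    operations of [smooth_algebra], which has neither opposites nor powers. *)
Lemma pdV_diff i h x : differentiable h x -> h x != 0 ->
  pd i (fun y => (h y)^-1) x = -1 * pd i h x * ((h x)^-1 * (h x)^-1).
Proof.
move=> dh h0; rewrite /pd (@deriveV _ _ h x) //; last exact: diff_derivable.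
by rewrite mulN1r mulNr -invfM -expr2 scaleNr [_ *: _]mulrC.
Qed.

Lemma pd_comp i (f : R -> R) h x : differentiable h x -> derivable f (h x) 1 ->
  pd i (fun y => f (h y)) x = derive1 f (h x) * pd i h x.
Proof.
move=> dh /derivable1_diffP df; rewrite /pd deriveE; last first.
  exact: (differentiable_comp dh df).
rewrite (diff_comp dh df) /= derive1E' // -(deriveE _ dh).
by rewrite -[X in 'd f _ X = _]mulr1 [LHS]linearZ mulrC.
Qed.

(* Analytic functions, products, sums and inverses of smooth functions: this
   class is stable under partial derivatives, so all its members are smooth. *)
Inductive smooth_algebra : scalar_field R -> Prop :=
| SASmooth h of smooth h : smooth_algebra h
| SAAdd h k of smooth_algebra h & smooth_algebra k :
    smooth_algebra (fun x => h x + k x)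
| SAMul h k of smooth_algebra h & smooth_algebra k :
    smooth_algebra (fun x => h x * k x)
| SAInv h of smooth_algebra h & (forall x, Omega x -> h x != 0) :
    smooth_algebra (fun x => (h x)^-1)
| SAComp (f : R -> R) U h of smooth_algebra h & analytic_on U f &
    (forall x, Omega x -> U (h x)) : smooth_algebra (fun x => f (h x)).

Lemma pds_cst s (c : R) : exists c', pds s (fun=> c) = fun=> c'.
Proof.
elim: s => [|i s [c' /= ->]]; first by exists c.
by exists 0; apply/funext => x; rewrite /pd derive_cst.
Qed.

Lemma smooth_cst (c : R) : smooth (fun=> c).
Proof. by move=> s x Ox; have [c' ->] := pds_cst s c; exact: differentiable_cst. Qed.

Lemma smooth_algebra_smooth h : smooth_algebra h -> smooth h.
Proof.
apply: smooth_coind => {}h.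
elim=> {h} [h sh|h k ah [dh ph] ak [dk pk]|h k ah [dh ph] ak [dk pk]
  |h ah [dh ph] h0|f U h ah [dh ph] fU hU].
- split=> [x Ox|i]; first exact: smooth_differentiable.
  by exists (pd i h) => //; apply/SASmooth/smooth_pd.
- split=> [x Ox|i]; first by apply: differentiableD; [exact: dh|exact: dk].
  have [h' ah' hh'] := ph i; have [k' ak' kk'] := pk i.
  exists (fun x => h' x + k' x); first exact: SAAdd.
  by move=> x Ox; rewrite pdD_diff ?hh' ?kk' //; [exact: dh|exact: dk].
- split=> [x Ox|i]; first by apply: differentiableM; [exact: dh|exact: dk].
  have [h' ah' hh'] := ph i; have [k' ak' kk'] := pk i.
  exists (fun x => h x * k' x + h' x * k x).
    by apply: SAAdd; apply: SAMul.
  by move=> x Ox; rewrite pdM_diff ?hh' ?kk' //; [exact: dh|exact: dk].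
- split=> [x Ox|i]; first by apply: differentiableV; [exact: dh|exact: h0].
  have [h' ah' hh'] := ph i.
  exists (fun x => -1 * h' x * ((h x)^-1 * (h x)^-1)).
    by do 2?[apply: SAMul]; rewrite //; do ?[exact: SAInv];
      exact/SASmooth/smooth_cst.
  by move=> x Ox; rewrite pdV_diff ?hh' //; [exact: dh|exact: h0].
(* $f'$ is again analytic on [U], so the chain rule stays inside the class. *)
- have [df af] := analytic_on_derive fU.
  split=> [x Ox|i].
    apply: differentiable_comp; first exact: dh.
    exact/derivable1_diffP/df/hU.
  have [h' ah' hh'] := ph i.
  exists (fun x => derive1 f (h x) * h' x).
    by apply: SAMul => //; apply: SAComp hU.
  by move=> x Ox; rewrite pd_comp ?hh' //; [exact: dh|exact/df/hU].
Qed.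

Lemma smoothD h k : smooth h -> smooth k -> smooth (fun x => h x + k x).
Proof. by move=> *; apply/smooth_algebra_smooth/SAAdd; exact: SASmooth. Qed.

Lemma smoothM h k : smooth h -> smooth k -> smooth (fun x => h x * k x).
Proof. by move=> *; apply/smooth_algebra_smooth/SAMul; exact: SASmooth. Qed.

Lemma smoothV h : smooth h -> (forall x, Omega x -> h x != 0) ->
  smooth (fun x => (h x)^-1).
Proof.
by move=> *; apply/smooth_algebra_smooth/SAInv => //; exact: SASmooth.
Qed.

Lemma smooth_comp (f : R -> R) U h : smooth h -> analytic_on U f ->
  (forall x, Omega x -> U (h x)) -> smooth (fun x => f (h x)).
Proof.
by move=> sh fU hU; apply: smooth_algebra_smooth; apply: SAComp fU hU;
  exact: SASmooth.
Qed.

Lemma smoothN h : smooth h -> smooth (fun x => - h x).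
Proof.
move=> sh; apply: (@smooth_ext (fun x => -1 * h x)); last first.
  exact/smoothM/sh/smooth_cst.
by move=> x _; rewrite mulN1r.
Qed.

Lemma smooth_sum (I : Type) (r : seq I) (F : I -> scalar_field R) :
  (forall a, smooth (F a)) -> smooth (fun x => \sum_(a <- r) F a x).
Proof.
move=> sF; elim: r => [|a r IH].
  by apply: smooth_ext (smooth_cst 0) => x _; rewrite big_nil.
by apply: smooth_ext (smoothD (sF a) IH) => x _; rewrite big_cons.
Qed.

Lemma smooth_prod (I : Type) (r : seq I) (F : I -> scalar_field R) :
  (forall a, smooth (F a)) -> smooth (fun x => \prod_(a <- r) F a x).
Proof.
move=> sF; elim: r => [|a r IH].
  by apply: smooth_ext (smooth_cst 1) => x _; rewrite big_nil.
by apply: smooth_ext (smoothM (sF a) IH) => x _; rewrite big_cons.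
Qed.

Lemma pdD i h k x : smooth h -> smooth k -> Omega x ->
  pd i (fun y => h y + k y) x = pd i h x + pd i k x.
Proof. by move=> *; apply: pdD_diff; exact: smooth_differentiable. Qed.

Lemma pdM i h k x : smooth h -> smooth k -> Omega x ->
  pd i (fun y => h y * k y) x = h x * pd i k x + pd i h x * k x.
Proof. by move=> *; apply: pdM_diff; exact: smooth_differentiable. Qed.

Lemma pd_cst i (c : R) x : pd i (fun=> c) x = 0.
Proof. exact: derive_cst. Qed.

Lemma pd_sum i (I : Type) (r : seq I) (F : I -> scalar_field R) x :
  (forall a, smooth (F a)) -> Omega x ->
  pd i (fun y => \sum_(a <- r) F a y) x = \sum_(a <- r) pd i (F a) x.
Proof.
move=> sF Ox; elim: r => [|a r IH].
  rewrite big_nil -[RHS](pd_cst i 0 x).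
  by apply: pd_ext Ox => y _; rewrite big_nil.
rewrite big_cons -IH -pdD //; last exact: smooth_sum.
by apply: pd_ext Ox => y _; rewrite big_cons.
Qed.

Lemma pd_comm i j h x : smooth h -> Omega x ->
  pd i (pd j h) x = pd j (pd i h) x.
Proof.
move=> sh Ox; apply: pdC.
- apply: near_Omega Ox => y Oy; split; apply: smooth_differentiable => //;
    exact: smooth_pd.
- apply: differentiable_continuous; apply: smooth_differentiable => //.
  exact/smooth_pd/smooth_pd.
- apply: differentiable_continuous; apply: smooth_differentiable => //.
  exact/smooth_pd/smooth_pd.
Qed.

End Partial.

(** * Matrix and index identities *)

Section MatrixIdentities.
Variable R : comPzRingType.

Lemma addmxE p q (M N : 'M[R]_(p, q)) i j : (M + N) i j = M i j + N i j.
Proof. by rewrite mxE. Qed.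

Lemma oppmxE p q (M : 'M[R]_(p, q)) i j : (- M) i j = - M i j.
Proof. by rewrite mxE. Qed.

Lemma trmxD p q (M N : 'M[R]_(p, q)) : (M + N)^T = M^T + N^T.
Proof. exact: linearD. Qed.

Lemma trmxN p q (M : 'M[R]_(p, q)) : (- M)^T = - M^T.
Proof. exact: linearN. Qed.

Lemma mxtrace_add n (M N : 'M[R]_n) : \tr (M + N) = \tr M + \tr N.
Proof. exact: raddfD. Qed.

Lemma mxtrace_opp n (M : 'M[R]_n) : \tr (- M) = - \tr M.
Proof. exact: raddfN. Qed.

(** For $H$ the inverse metric, the first factor is $dH$: the derivative of $\mathrm{tr}(HT)$ is the
    trace of $H\nabla T$. Cyclicity of the trace moves $A$ across. *)
Lemma trace_covariant n (H A T dT : 'M[R]_n) :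
  \tr (- (H *m A^T + A *m H) *m T + H *m dT) =
  \tr (H *m (dT - A^T *m T - T *m A)).
Proof.
rewrite !(mulNmx, mulmxN, mulmxDl, mulmxDr) !mulmxA.
rewrite !(mxtrace_add, mxtrace_opp) -(mulmxA A) (mxtrace_mulC A).
by rewrite opprD addrC addrA.
Qed.

(* Here [mn] and [nm] stand for the derivatives of the connection matrices;
   the hypothesis says that the second derivatives of the metric commute. *)
Lemma curvature_skew n (g Am An mn nm : 'M[R]_n) :
  mn^T *m g + An^T *m (Am^T *m g + g *m Am) + (Am^T *m g + g *m Am) *m An
    + g *m mn =
  nm^T *m g + Am^T *m (An^T *m g + g *m An) + (An^T *m g + g *m An) *m Am
    + g *m nm ->
  let F := mn - nm + Am *m An - An *m Am in
  F^T *m g + g *m F = 0.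
Proof.
move/eqP; rewrite -subr_eq0 => /eqP E F; rewrite -{}E /F.
rewrite !(trmxD, trmxN, trmx_mul).
rewrite !(mulmxDl, mulmxDr, mulmxN, mulNmx) !mulmxA.
apply/matrixP => i j; rewrite !(addmxE, oppmxE).
ring.
Qed.

(* [AB] stands for the derivative of [B] in the direction of [A], and [ABC] for
   the second derivative d_A d_B C. *)
Lemma bianchi_matrix n (A B C : 'M[R]_n) (AB AC BA BC CA CB : 'M[R]_n)
    (ABC BAC BCA CBA CAB ACB : 'M[R]_n) : ABC = BAC -> BCA = CBA -> CAB = ACB ->
  (ABC - ACB + (AB *m C + B *m AC - (AC *m B + C *m AB))
     + A *m (BC - CB + B *m C - C *m B) - (BC - CB + B *m C - C *m B) *m A)
  + (BCA - BAC + (BC *m A + C *m BA - (BA *m C + A *m BC))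
     + B *m (CA - AC + C *m A - A *m C) - (CA - AC + C *m A - A *m C) *m B)
  + (CAB - CBA + (CA *m B + A *m CB - (CB *m A + B *m CA))
     + C *m (AB - BA + A *m B - B *m A) - (AB - BA + A *m B - B *m A) *m C)
  = 0.
Proof.
move=> -> -> ->.
rewrite !(mulmxDl, mulmxDr, mulmxN, mulNmx) !mulmxA.
apply/matrixP => i j; rewrite !(addmxE, oppmxE) [RHS]mxE.
ring.
Qed.

(** [w] is a covector, [wk], [wl], [wkl] are its derivatives, and [kl], [lk] stand for $\partial_k
    A_l$, $\partial_l A_k$. Sharing [wkl] between both orders encodes Schwarz's theorem. *)
Lemma ricci_identity_matrix n (w wk wl wkl : 'rV[R]_n) (Ak Al kl lk : 'M[R]_n) :
  wkl - (wk *m Al + w *m kl) - (wl - w *m Al) *m Ak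
  - (wkl - (wl *m Ak + w *m lk) - (wk - w *m Ak) *m Al)
  = - (w *m (kl - lk + Ak *m Al - Al *m Ak)).
Proof.
rewrite !(mulmxDl, mulmxDr, mulmxN, mulNmx) !mulmxA.
apply/matrixP => i j; rewrite !(addmxE, oppmxE); ring.
Qed.

Lemma grad_dot_matrix n (v w dv dw : 'rV[R]_n) (A H : 'M[R]_n) :
  (dv *m H + v *m - (H *m A^T + A *m H)) *m w^T + v *m H *m dw^T =
  (dv - v *m A) *m H *m w^T + v *m H *m (dw - w *m A)^T.
Proof.
rewrite !(trmxD, trmxN, trmx_mul).
rewrite !(mulmxDl, mulmxDr, mulmxN, mulNmx) !mulmxA.
apply/matrixP => i j; rewrite !(addmxE, oppmxE); ring.
Qed.

Lemma stress_arith (a b c d : R) : a + c + (b + d) - (d + c) = a + b.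
Proof. by ring. Qed.

Lemma split_term (c d e u v z : R) :
  d * u * v - c * (z * (e * u * v)) = (d - c * z * e) * u * v.
Proof. by ring. Qed.

Lemma trmx11 (M : 'M[R]_1) : M^T ord0 ord0 = M ord0 ord0.
Proof. by rewrite mxE. Qed.
End MatrixIdentities.

(** The final balance, with $a=R_{mn}\nabla^m h$, $b=\partial_n\Box h$, $r=R$, $p=f'(X)$,
    $u=\partial_n X$, $v=\partial_n Y$. *)
Lemma field_equation_arith (R : realFieldType) (a b r p u v : R) :
  a - 2^-1 * r * (p * u + v)
    + (b + (-1 * (b + a) + 2^-1 * (r * p * u + r * v))) = 0.
Proof. by ring. Qed.

(** * Contraction of the second Bianchi identity *)

Section Contraction.
Variables (R : comPzRingType) (n : nat).
(* [dF k a b] and [dH k] play the role of the k-th partial derivatives of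
   [F a b] and [H]. *)
Variables (A : 'I_n -> 'M[R]_n) (F : 'I_n -> 'I_n -> 'M[R]_n).
Variable dF : 'I_n -> 'I_n -> 'I_n -> 'M[R]_n.
Variables (H : 'M[R]_n) (dH : 'I_n -> 'M[R]_n).
Hypothesis A_sym : forall k a b, A k a b = A b a k.
Hypothesis F_anti : forall a b, F a b = - F b a.
Hypothesis dF_anti : forall k a b, dF k a b = - dF k b a.
Hypothesis H_sym : H^T = H.
Hypothesis dHE : forall k, dH k = - (H *m (A k)^T + A k *m H).

(** This is $\nabla_k F_{ab}$: the commutator with $A_k$ acts on the matrix indices, the two sums
    correct the form indices. *)
Definition cov_curv k a b : 'M[R]_n :=
  dF k a b + A k *m F a b - F a b *m A k
  - \sum_c A k c a *: F c b - \sum_c A k c b *: F a c.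

(** The Ricci contraction $R^c{}_{lcb}$, applied both to the curvature and to its derivatives. *)
Definition trace_curv (F' : 'I_n -> 'I_n -> 'M[R]_n) : 'M[R]_n :=
  \matrix_(l, b) \sum_c F' c b c l.

Definition cov_form2 k (dT T : 'M[R]_n) : 'M[R]_n :=
  dT - (A k)^T *m T - T *m A k.

Lemma cov_curv_anti k a b : cov_curv k a b = - cov_curv k b a.
Proof.
rewrite /cov_curv dF_anti F_anti mulmxN mulNmx !opprD !opprK.
have E x y : \sum_c A k c x *: F y c = - \sum_c A k c x *: F c y.
  by rewrite -sumrN; apply: eq_bigr => c _; rewrite F_anti scalerN.
by rewrite (E b a) (E a b) !opprK addrAC.
Qed.

(** Absence of torsion ([A_sym]) and antisymmetry of $F$ make the form-index corrections cancel in
    pairs over the cyclic sum. *)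
Lemma cov_curv_cyclic k a b :
  (dF k a b + A k *m F a b - F a b *m A k)
  + (dF a b k + A a *m F b k - F b k *m A a)
  + (dF b k a + A b *m F k a - F k a *m A b) = 0 ->
  cov_curv k a b + cov_curv a b k + cov_curv b k a = 0.
Proof.
move=> E.
have swap x y z : \sum_c A x c y *: F c z = - \sum_c A y c x *: F z c.
  by rewrite -sumrN; apply: eq_bigr => c _; rewrite A_sym F_anti scalerN.
rewrite -[RHS]E /cov_curv (swap k a b) (swap a b k) (swap b k a) !opprK.
apply/matrixP => i j; rewrite !(addmxE, oppmxE); ring.
Qed.

(** Contraction commutes with $\nabla$: the corrections of the upper and the lower contracted index
    are opposite. *)
Lemma cov_curv_trace k b l :
  \sum_c cov_curv k c b c l =
  cov_form2 k (trace_curv (dF k)) (trace_curv F) l b.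
Proof.
rewrite /cov_curv /cov_form2 !(addmxE, oppmxE) ![(_ *m _) l b]mxE mxE.
under eq_bigr do rewrite !(addmxE, oppmxE) !summxE.
rewrite !big_split /= !sumrN -!addrA; congr (_ + _).
have -> : \sum_c (A k *m F c b) c l = \sum_c \sum_a (A k a c *: F a b) c l.
  under eq_bigr do rewrite mxE.
  by rewrite exchange_big; do 2!apply: eq_bigr => ? _; rewrite mxE.
have -> : \sum_c (F c b *m A k) c l = \sum_j (A k)^T l j * trace_curv F j b.
  under eq_bigr do rewrite mxE.
  rewrite exchange_big; apply: eq_bigr => a _; rewrite !mxE mulr_sumr.
  by apply: eq_bigr => c _; rewrite mulrC.
have -> : \sum_c \sum_a (A k a b *: F c a) c l =
    \sum_j trace_curv F l j * A k j b.
  rewrite exchange_big; apply: eq_bigr => a _; rewrite !mxE mulr_suml.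
  by apply: eq_bigr => c _; rewrite mxE mulrC.
by rewrite addrCA addNKr.
Qed.

(** This is $R^{cm}{}_{mb}$: the lower matrix index is raised by $H$ and contracted with the first
    form index. *)
Definition raised_trace (F' : 'I_n -> 'I_n -> 'M[R]_n) : 'M[R]_n :=
  \matrix_(c, b) \sum_m (F' m b *m H) c m.

(** The two terms of [dHE] supply the corrections of the contracted indices: $FA_kH$ that of the
    lower matrix index, $FHA_k^T$ that of the first form index. *)
Lemma cov_raised_trace k (dS : 'M[R]_n) :
  dS = \matrix_(c, b) \sum_m (dF k m b *m H + F m b *m dH k) c m ->
  dS + A k *m raised_trace F - raised_trace F *m A k =
  raised_trace (cov_curv k).
Proof.
move=> ->; apply/matrixP => c b.
rewrite !(addmxE, oppmxE) ![(_ *m _) c b]mxE.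
rewrite [X in X + _ - _]mxE [RHS]mxE.
under [RHS]eq_bigr do
  rewrite /cov_curv !mulmxDl !mulNmx !mulmx_suml !(addmxE, oppmxE) !summxE.
under [X in X + _ - _]eq_bigr do rewrite dHE mulmxN mulmxDr !(addmxE, oppmxE) !mulmxA.
rewrite !big_split /= !sumrN big_split /=.
have -> : \sum_j A k c j * raised_trace F j b = \sum_m (A k *m F m b *m H) c m.
  under eq_bigr do rewrite mxE mulr_sumr.
  rewrite exchange_big; apply: eq_bigr => m _; rewrite -mulmxA [RHS]mxE.
  by apply: eq_bigr => j _.
have -> : \sum_j raised_trace F c j * A k j b =
    \sum_m \sum_a (A k a b *: F m a *m H) c m.
  under eq_bigr do rewrite mxE mulr_suml.
  rewrite exchange_big; do 2!apply: eq_bigr => ? _.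
  by rewrite -scalemxAl [RHS]mxE mulrC.
have -> : \sum_m (F m b *m H *m (A k)^T) c m =
    \sum_m \sum_a (A k a m *: F a b *m H) c m.
  under eq_bigr do rewrite mxE.
  rewrite exchange_big; do 2!apply: eq_bigr => ? _.
  by rewrite -scalemxAl [RHS]mxE [(A k)^T _ _]mxE mulrC.
ring.
Qed.

(* The three terms of the cyclic identity, contracted with [H], are respectively
   [- div Ric], [- div Ric] and [d(tr Ric)]. *)
Lemma contracted_bianchi b (dS : 'I_n -> 'M[R]_n) :
  (forall k a c, cov_curv k a c + cov_curv a c k + cov_curv c k a = 0) ->
  (forall k, dS k =
     \matrix_(c, b) \sum_m (dF k m b *m H + F m b *m dH k) c m) ->
  raised_trace F = - (H *m trace_curv F) ->
  (forall k, dS k = - (dH k *m trace_curv F + H *m trace_curv (dF k))) ->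
  let nabRic k := cov_form2 k (trace_curv (dF k)) (trace_curv F) in
  \tr (H *m nabRic b) = (\sum_l (H *m nabRic l) l b) *+ 2.
Proof.
move=> cyc dS1 SE dS2 nabRic.
have Hs i j : H i j = H j i by rewrite -{1}H_sym mxE.
(* The derivative [dS k] is known in two ways, from the definition of the raised trace and from its
   value $-H\,\mathrm{Ric}$; equating the covariant derivatives gives the claim. *)
have T1 k : raised_trace (cov_curv k) = - (H *m nabRic k).
  rewrite -(cov_raised_trace (dS1 k)) SE dS2 dHE /nabRic /cov_form2.
  rewrite !(mulmxN, mulNmx, mulmxDl, mulmxDr) !mulmxA.
  apply/matrixP => i j; rewrite !(addmxE, oppmxE); ring.
have : \sum_k \sum_m ((cov_curv k m b + cov_curv m b k + cov_curv b k m)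
    *m H) k m = 0.
  by do 2![apply: big1 => ? _]; rewrite cyc mul0mx mxE.
have -> : \sum_k \sum_m ((cov_curv k m b + cov_curv m b k + cov_curv b k m)
    *m H) k m = \sum_k raised_trace (cov_curv k) k b
      + \sum_k \sum_m (cov_curv m b k *m H) k m
      + \sum_k \sum_m (cov_curv b k m *m H) k m.
  rewrite -!big_split; apply: eq_bigr => k _; rewrite /= [raised_trace _ _ _]mxE.
  rewrite -!big_split; apply: eq_bigr => m _.
  by rewrite !mulmxDl !addmxE.
have -> : \sum_k raised_trace (cov_curv k) k b = - \sum_k (H *m nabRic k) k b.
  by rewrite -sumrN; apply: eq_bigr => k _; rewrite T1 oppmxE.
have -> : \sum_k \sum_m (cov_curv m b k *m H) k m =
    - \sum_k (H *m nabRic k) k b.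
  rewrite exchange_big -sumrN /=; apply: eq_bigr => m _.
  under eq_bigr do rewrite cov_curv_anti mulNmx oppmxE mxE.
  rewrite sumrN exchange_big mxE; congr (- _); apply: eq_bigr => l _ /=.
  rewrite /nabRic -cov_curv_trace mulr_sumr.
  by apply: eq_bigr => k _; rewrite mulrC Hs.
have -> : \sum_k \sum_m (cov_curv b k m *m H) k m = \tr (H *m nabRic b).
  rewrite exchange_big; apply: eq_bigr => m _; rewrite mxE.
  under eq_bigr do rewrite mxE.
  rewrite exchange_big; apply: eq_bigr => l _ /=.
  rewrite /nabRic -cov_curv_trace mulr_sumr.
  by apply: eq_bigr => k _; rewrite mulrC Hs.
move/eqP; rewrite addrC addr_eq0 => /eqP ->.
by rewrite opprD !opprK mulr2n.
Qed.
End Contraction.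

(** * Calculus of matrix-valued functions *)

Section MatrixCalculus.
Variables (R : realType) (Omega : set 'rV[R]_4).
Hypothesis openO : open Omega.
Local Notation V := 'rV[R]_4.
Local Notation smooth := (smooth_on Omega).
Implicit Types (p q r : nat) (k : 'I_4) (x : V).

Definition smooth_mx p q (M : V -> 'M[R]_(p, q)) :=
  forall i j, smooth (fun x => M x i j).

Definition pdmx p q k (M : V -> 'M[R]_(p, q)) x : 'M[R]_(p, q) :=
  \matrix_(i, j) pd k (fun y => M y i j) x.

Lemma smooth_mx_ext p q (M N : V -> 'M[R]_(p, q)) :
  (forall x, Omega x -> M x = N x) -> smooth_mx M -> smooth_mx N.
Proof.
by move=> MN sM i j; apply: smooth_ext (sM i j) => // x Ox; rewrite MN.
Qed.

Lemma smooth_mxD p q (M N : V -> 'M[R]_(p, q)) :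
  smooth_mx M -> smooth_mx N -> smooth_mx (fun x => M x + N x).
Proof.
move=> sM sN i j; apply: smooth_ext (smoothD openO (sM i j) (sN i j)) => // x _.
by rewrite mxE.
Qed.

Lemma smooth_mxN p q (M : V -> 'M[R]_(p, q)) :
  smooth_mx M -> smooth_mx (fun x => - M x).
Proof.
move=> sM i j; apply: smooth_ext (smoothN openO (sM i j)) => // x _.
by rewrite mxE.
Qed.

Lemma smooth_mxB p q (M N : V -> 'M[R]_(p, q)) :
  smooth_mx M -> smooth_mx N -> smooth_mx (fun x => M x - N x).
Proof. by move=> sM /smooth_mxN; apply: smooth_mxD. Qed.

Lemma smooth_mxZ p q (s : scalar_field R) (M : V -> 'M[R]_(p, q)) :
  smooth s -> smooth_mx M -> smooth_mx (fun x => s x *: M x).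
Proof.
move=> ss sM i j; apply: smooth_ext (smoothM openO ss (sM i j)) => // x _.
by rewrite mxE.
Qed.

Lemma smooth_mxM p q r (M : V -> 'M[R]_(p, q)) (N : V -> 'M[R]_(q, r)) :
  smooth_mx M -> smooth_mx N -> smooth_mx (fun x => M x *m N x).
Proof.
move=> sM sN i j.
apply: (@smooth_ext _ _ openO (fun x => \sum_a M x i a * N x a j)).
  by move=> x _; rewrite mxE.
by apply: smooth_sum => // a; apply: smoothM.
Qed.

Lemma smooth_mxT p q (M : V -> 'M[R]_(p, q)) :
  smooth_mx M -> smooth_mx (fun x => (M x)^T).
Proof. by move=> sM i j; apply: smooth_ext (sM j i) => // x _; rewrite mxE. Qed.

Lemma smooth_pdmx p q k (M : V -> 'M[R]_(p, q)) :
  smooth_mx M -> smooth_mx (pdmx k M).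
Proof.
move=> sM i j; apply: smooth_ext (smooth_pd k (sM i j)) => // x _.
by rewrite mxE.
Qed.

Lemma smooth_trace p (M : V -> 'M[R]_p) :
  smooth_mx M -> smooth (fun x => \tr (M x)).
Proof. by move=> sM; apply: smooth_sum. Qed.

Lemma smooth_det p (M : V -> 'M[R]_p) :
  smooth_mx M -> smooth (fun x => \det (M x)).
Proof.
move=> sM; rewrite /determinant; apply: smooth_sum => // s.
by apply: smoothM => //; [exact: smooth_cst | exact: smooth_prod].
Qed.

Lemma smooth_adj p (M : V -> 'M[R]_p) :
  smooth_mx M -> smooth_mx (fun x => \adj (M x)).
Proof.
move=> sM i j.
apply: (@smooth_ext _ _ openO
  (fun x => (-1) ^+ (j + i) * \det (row' j (col' i (M x))))).
  by move=> x _; rewrite mxE.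
apply: smoothM => //; first exact: smooth_cst.
apply: smooth_det => a b; apply: smooth_ext (sM (lift j a) (lift i b)) => // x _.
by rewrite !mxE.
Qed.

(** Cramer's formula, valid on [Omega], reduces the claim to polynomials in the entries and the
    inverse of a nonvanishing determinant. *)
Lemma smooth_invmx p (M : V -> 'M[R]_p) :
  smooth_mx M -> (forall x, Omega x -> M x \in unitmx) ->
  smooth_mx (fun x => invmx (M x)).
Proof.
move=> sM uM.
apply: (@smooth_mx_ext _ _ (fun x => (\det (M x))^-1 *: \adj (M x))).
  by move=> x Ox; rewrite /invmx uM.
apply: smooth_mxZ; last exact: smooth_adj.
apply: smoothV => //; first exact: smooth_det.
by move=> x Ox; rewrite -unitfE -unitmxE uM.
Qed.

Lemma pdmx_ext p q k (M N : V -> 'M[R]_(p, q)) x :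
  (forall y, Omega y -> M y = N y) -> Omega x -> pdmx k M x = pdmx k N x.
Proof.
move=> MN Ox; apply/matrixP => i j; rewrite !mxE.
by apply: (pd_ext openO) => // y Oy; rewrite MN.
Qed.

Lemma pdmxD p q k (M N : V -> 'M[R]_(p, q)) x :
  smooth_mx M -> smooth_mx N -> Omega x ->
  pdmx k (fun y => M y + N y) x = pdmx k M x + pdmx k N x.
Proof.
move=> sM sN Ox; apply/matrixP => i j; rewrite !mxE -(pdD k (sM i j) (sN i j) Ox).
by apply: (pd_ext openO) => // y _; rewrite mxE.
Qed.

Lemma pdmxM p q r k (M : V -> 'M[R]_(p, q)) (N : V -> 'M[R]_(q, r)) x :
  smooth_mx M -> smooth_mx N -> Omega x ->
  pdmx k (fun y => M y *m N y) x = pdmx k M x *m N x + M x *m pdmx k N x.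
Proof.
move=> sM sN Ox; apply/matrixP => i j; rewrite !mxE -big_split /=.
rewrite (@pd_ext _ _ openO k _ (fun y => \sum_a M y i a * N y a j)) //; last first.
  by move=> y _; rewrite mxE.
rewrite (pd_sum openO) //; last by move=> a; apply: smoothM.
by apply: eq_bigr => a _; rewrite !mxE (pdM k (sM i a) (sN a j) Ox) addrC.
Qed.

Lemma pdmxZ p q k (s : scalar_field R) (M : V -> 'M[R]_(p, q)) x :
  smooth s -> smooth_mx M -> Omega x ->
  pdmx k (fun y => s y *: M y) x = pd k s x *: M x + s x *: pdmx k M x.
Proof.
move=> ss sM Ox; apply/matrixP => i j; rewrite !mxE addrC.
rewrite -(pdM k ss (sM i j) Ox).
by apply: (pd_ext openO) => // y _; rewrite mxE.
Qed.

Lemma pdmxN p q k (M : V -> 'M[R]_(p, q)) x : smooth_mx M -> Omega x ->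
  pdmx k (fun y => - M y) x = - pdmx k M x.
Proof.
move=> sM Ox.
rewrite (@pdmx_ext _ _ k _ (fun y => (fun=> -1) y *: M y)) //; last first.
  by move=> y _; rewrite scaleN1r.
rewrite pdmxZ //; last exact: smooth_cst.
by rewrite pd_cst scale0r add0r scaleN1r.
Qed.

Lemma pdmxB p q k (M N : V -> 'M[R]_(p, q)) x :
  smooth_mx M -> smooth_mx N -> Omega x ->
  pdmx k (fun y => M y - N y) x = pdmx k M x - pdmx k N x.
Proof. by move=> sM sN Ox; rewrite pdmxD ?pdmxN //; exact: smooth_mxN. Qed.

Lemma pdmxT p q k (M : V -> 'M[R]_(p, q)) x : Omega x ->
  pdmx k (fun y => (M y)^T) x = (pdmx k M x)^T.
Proof.
move=> Ox; apply/matrixP => i j; rewrite !mxE.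
by apply: (pd_ext openO) => // y _; rewrite mxE.
Qed.

Lemma pdmx_comm p q k l (M : V -> 'M[R]_(p, q)) x :
  smooth_mx M -> Omega x -> pdmx k (pdmx l M) x = pdmx l (pdmx k M) x.
Proof.
move=> sM Ox; apply/matrixP => i j; rewrite [LHS]mxE [RHS]mxE.
have E a b : pd a (fun y => pdmx b M y i j) x = pd a (pd b (fun y => M y i j)) x.
  by apply: (pd_ext openO) Ox => y _; rewrite mxE.
by rewrite !E; apply: (pd_comm openO).
Qed.

Lemma pd_trace p k (M : V -> 'M[R]_p) x : smooth_mx M -> Omega x ->
  pd k (fun y => \tr (M y)) x = \tr (pdmx k M x).
Proof.
move=> sM Ox; rewrite (pd_sum openO) //.
by apply: eq_bigr => i _; rewrite mxE.
Qed.
End MatrixCalculus.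

(** * Connection, curvature and divergences *)

Lemma unitmxN (R : comUnitRingType) n (M : 'M[R]_n) :
  (- M \in unitmx) = (M \in unitmx).
Proof. by rewrite -scaleN1r unitmxZ // unitrN1. Qed.

Lemma minkowski_unit (R : realType) : Defs.minkowski R \in unitmx.
Proof.
rewrite unitmxE det_diag unitfE; apply/prodf_neq0 => i _; rewrite mxE.
by case: ifP => _; rewrite ?oppr_eq0 oner_eq0.
Qed.

Lemma lorentzian_unit (R : realType) (m : 'M[R]_4) :
  lorentzian m -> m \in unitmx.
Proof.
move=> [_ [P uP E]].
have : P *m m *m P^T \in unitmx.
  by case: E => ->; rewrite ?unitmxN minkowski_unit.
by rewrite !unitmx_mul => /andP[/andP[]].
Qed.

Section Geometry.
Variables (R : realType) (Omega : set 'rV[R]_4).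
Hypothesis openO : open Omega.
Variable g : tensor2 R.
Hypothesis hg : lorentzian_metric Omega g.
Local Notation V := 'rV[R]_4.
Local Notation smooth := (smooth_on Omega).
Local Notation smooth_mx := (smooth_mx Omega).
Local Notation H := (ginv g).
Implicit Types (k l m n a b c : 'I_4) (x : V).

(* [conn k] is the matrix of the connection form: its (a, b) entry is
   Gamma^a_(k b). *)
Definition conn k x : 'M[R]_4 := \matrix_(a, b) christoffel g a k b x.

(** The Christoffel symbols of the first kind. *)
Definition lower_conn k x : 'M[R]_4 :=
  \matrix_(d, b) (2^-1 * (pd k (fun y => g y d b) x + pd b (fun y => g y d k) x
                          - pd d (fun y => g y k b) x)).

(* [curv m n] has (c, l) entry R^c_(l m n). *)
Definition curv m n x : 'M[R]_4 := \matrix_(c, l) riemann g c l m n x.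

(** * The metric and its Levi-Civita connection *)

Lemma metric_sym x : Omega x -> (g x)^T = g x.
Proof. by move=> /(proj2 hg)[]. Qed.

Lemma metric_unit x : Omega x -> g x \in unitmx.
Proof. by move=> /(proj2 hg)/lorentzian_unit. Qed.

Lemma ginv_sym x : Omega x -> (H x)^T = H x.
Proof. by move=> Ox; rewrite /ginv trmx_inv metric_sym. Qed.

Lemma ginvK x : Omega x -> H x *m g x = 1%:M.
Proof. by move=> Ox; rewrite /ginv mulVmx // metric_unit. Qed.

Lemma metricK x : Omega x -> g x *m H x = 1%:M.
Proof. by move=> Ox; rewrite /ginv mulmxV // metric_unit. Qed.

Lemma smooth_metric : smooth_mx g.
Proof. exact: (proj1 hg). Qed.

Lemma smooth_ginv : smooth_mx H.
Proof. by apply: smooth_invmx => //; [exact: smooth_metric | exact: metric_unit]. Qed.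

Lemma connE k x : conn k x = H x *m lower_conn k x.
Proof.
apply/matrixP => a b; rewrite !mxE /christoffel mulr_sumr.
by apply: eq_bigr => d _; rewrite mxE mulrCA.
Qed.

Lemma smooth_lower_conn k : smooth_mx (lower_conn k).
Proof.
move=> d b; apply: (@smooth_ext _ _ openO (fun x => 2^-1 *
    (pd k (fun y => g y d b) x + pd b (fun y => g y d k) x
     + - pd d (fun y => g y k b) x))).
  by move=> x _; rewrite mxE.
apply: smoothM => //; first exact: smooth_cst.
apply: smoothD => //; first apply: smoothD => //.
- exact/smooth_pd/smooth_metric.
- exact/smooth_pd/smooth_metric.
- exact/smoothN/smooth_pd/smooth_metric.
Qed.

Lemma smooth_conn k : smooth_mx (conn k).
Proof.
apply: (@smooth_mx_ext _ _ openO _ _ (fun x => H x *m lower_conn k x)).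
  by move=> x _; rewrite connE.
by apply: smooth_mxM => //; [exact: smooth_ginv | exact: smooth_lower_conn].
Qed.

Lemma pd_metric_sym k a b x : Omega x ->
  pd k (fun y => g y a b) x = pd k (fun y => g y b a) x.
Proof.
move=> Ox; apply: (pd_ext openO) Ox => y Oy.
by rewrite -{1}(metric_sym Oy) mxE.
Qed.

Lemma conn_sym k a b x : Omega x -> conn k x a b = conn b x a k.
Proof.
move=> Ox; rewrite !connE !mxE; apply: eq_bigr => d _; rewrite !mxE.
by rewrite (pd_metric_sym d k b Ox) [X in X - _]addrC.
Qed.

Lemma metric_conn k x : Omega x -> g x *m conn k x = lower_conn k x.
Proof. by move=> Ox; rewrite connE mulKVmx // metric_unit. Qed.

(** Metric compatibility: in [lower_conn k] the last two terms are skew, so adding the transpose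
    leaves $\partial_k g$. *)
Lemma pdmx_metric k x : Omega x ->
  pdmx k g x = (conn k x)^T *m g x + g x *m conn k x.
Proof.
move=> Ox; rewrite -[in X in X + _](metric_sym Ox) -trmx_mul metric_conn //.
apply/matrixP => a b; rewrite !mxE.
rewrite (pd_metric_sym k b a Ox) (pd_metric_sym b k a Ox).
rewrite (pd_metric_sym a k b Ox).
move: (pd k _ x) (pd a _ x) (pd b _ x) => u v w; by field.
Qed.

(** Obtained by differentiating $g^{-1}g=1$. *)
Lemma pdmx_ginv k x : Omega x ->
  pdmx k H x = - (H x *m (conn k x)^T + conn k x *m H x).
Proof.
move=> Ox; have : pdmx k (fun y => H y *m g y) x = 0.
  rewrite (@pdmx_ext _ _ openO _ _ k _ (fun=> 1%:M)) //.
    by apply/matrixP => i j; rewrite mxE pd_cst mxE.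
  by move=> y Oy; rewrite ginvK.
rewrite (pdmxM openO) //; [|exact: smooth_ginv|exact: smooth_metric].
move/eqP; rewrite addr_eq0 => /eqP E.
rewrite -[LHS]mulmx1 -(metricK Ox) mulmxA E pdmx_metric // mulNmx.
rewrite mulmxDr mulmxDl !mulmxA (ginvK Ox) mul1mx.
by rewrite -[X in X + _]mulmxA (metricK Ox) mulmx1.
Qed.

(** * Curvature, its symmetries and the Ricci tensor *)

Lemma curvE m n x : curv m n x = pdmx m (conn n) x - pdmx n (conn m) x
  + conn m x *m conn n x - conn n x *m conn m x.
Proof.
apply/matrixP => c l; rewrite !mxE /riemann -addrA; congr (_ - _ + _).
- by congr (pd m _ x); apply/funext => y; rewrite mxE.
- by congr (pd n _ x); apply/funext => y; rewrite mxE.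
- by rewrite sumrB; congr (_ - _); apply: eq_bigr => d _; rewrite !mxE.
Qed.

Lemma smooth_curv m n : smooth_mx (curv m n).
Proof.
apply: (@smooth_mx_ext _ _ openO _ _ (fun x => pdmx m (conn n) x
  - pdmx n (conn m) x + conn m x *m conn n x - conn n x *m conn m x)).
  by move=> x _; rewrite curvE.
have s := smooth_conn.
by apply: smooth_mxB => //; [apply: smooth_mxD => //;
  [apply: smooth_mxB => //|]|]; (apply: smooth_pdmx || apply: smooth_mxM).
Qed.

Lemma curv_anti m n x : curv m n x = - curv n m x.
Proof.
rewrite !curvE !opprD !opprK [X in _ = X + _ + _]addrC.
by rewrite -!addrA; congr (_ + (_ + _)); rewrite addrC.
Qed.

Lemma pdmx_curv_anti k m n x : Omega x ->
  pdmx k (curv m n) x = - pdmx k (curv n m) x.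
Proof.
move=> Ox; rewrite -(pdmxN openO) //; last exact: smooth_curv.
by apply: (pdmx_ext openO) Ox => y _; exact: curv_anti.
Qed.

Lemma pdmx_pdmx_metric m n x : Omega x -> pdmx m (pdmx n g) x =
  (pdmx m (conn n) x)^T *m g x
  + (conn n x)^T *m ((conn m x)^T *m g x + g x *m conn m x)
  + ((conn m x)^T *m g x + g x *m conn m x) *m conn n x
  + g x *m pdmx m (conn n) x.
Proof.
move=> Ox; have sc := smooth_conn n; have sg := smooth_metric.
rewrite (pdmx_ext openO m (pdmx_metric n)) // (pdmxD openO) //; last 2 first.
- by apply: smooth_mxM => //; apply: smooth_mxT.
- exact: smooth_mxM.
rewrite !(pdmxM openO) //; last exact: smooth_mxT.
by rewrite (pdmxT openO) // pdmx_metric // !addrA.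
Qed.

Lemma curv_skew m n x : Omega x ->
  (curv m n x)^T *m g x + g x *m curv m n x = 0.
Proof.
move=> Ox; rewrite curvE; apply: curvature_skew.
rewrite -(pdmx_pdmx_metric m n Ox) -(pdmx_pdmx_metric n m Ox).
exact: (pdmx_comm openO _ _ smooth_metric Ox).
Qed.

(** Multiplying the skewness of $R_{clmn}$ in $c,l$ by $g^{-1}$ on both sides raises both
    indices. *)
Lemma curv_ginv_skew m n x : Omega x ->
  curv m n x *m H x = - (curv m n x *m H x)^T.
Proof.
move=> Ox.
rewrite trmx_mul ginv_sym //; apply/eqP; rewrite -addr_eq0; apply/eqP.
have := congr1 (fun M => H x *m M *m H x) (curv_skew m n Ox).
rewrite mulmx0 mul0mx mulmxDr mulmxDl => E; rewrite -[RHS]E addrC.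
rewrite !mulmxA (ginvK Ox) mul1mx; congr (_ + _).
by rewrite -[RHS]mulmxA (metricK Ox) mulmx1.
Qed.

Lemma pdmx_curvE k a b x : Omega x -> pdmx k (curv a b) x =
  pdmx k (pdmx a (conn b)) x - pdmx k (pdmx b (conn a)) x
  + (pdmx k (conn a) x *m conn b x + conn a x *m pdmx k (conn b) x
     - (pdmx k (conn b) x *m conn a x + conn b x *m pdmx k (conn a) x)).
Proof.
move=> Ox; have sc := smooth_conn.
have scp c d := smooth_pdmx openO c (sc d).
have scm c d := smooth_mxM openO (sc c) (sc d).
rewrite (pdmx_ext openO k (fun y _ => curvE a b y) Ox).
rewrite (pdmxB openO) //; last first.
  by apply: smooth_mxD => //; apply: smooth_mxB.
rewrite (pdmxD openO) //; last exact: smooth_mxB.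
by rewrite (pdmxB openO) // !(pdmxM openO) // [RHS]addrA.
Qed.

Lemma ricciE x : ricci g x = trace_curv (fun a b => curv a b x).
Proof.
by apply/matrixP => i j; rewrite !mxE; apply: eq_bigr => c _; rewrite mxE.
Qed.

Lemma smooth_ricci : smooth_mx (ricci g).
Proof.
move=> i j; apply: (@smooth_ext _ _ openO (fun x => \sum_c curv c j x c i)).
  by move=> x _; rewrite ricciE mxE.
by apply: smooth_sum => // c; exact: smooth_curv.
Qed.

Lemma pdmx_ricci k x : Omega x ->
  pdmx k (ricci g) x = trace_curv (fun a b => pdmx k (curv a b) x).
Proof.
move=> Ox; apply/matrixP => i j; rewrite !mxE.
transitivity (pd k (fun y => \sum_c curv c j y c i) x).
  by apply: (pd_ext openO) Ox => y _; rewrite ricciE mxE.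
rewrite (pd_sum openO) //; last by move=> c; exact: smooth_curv.
by apply: eq_bigr => c _; rewrite mxE.
Qed.

(** Skewness of $R^{cm}{}_{mb}$ in its raised pair turns this contraction into minus the Ricci
    one. *)
Lemma raised_curvE x : Omega x ->
  raised_trace (H x) (fun a b => curv a b x) = - (H x *m ricci g x).
Proof.
move=> Ox; apply/matrixP => c n; rewrite mxE oppmxE mxE -sumrN.
have Hs i j : H x i j = H x j i by rewrite -{1}(ginv_sym Ox) mxE.
transitivity (\sum_m - \sum_l curv m n x m l * H x l c).
  by apply: eq_bigr => m _; rewrite curv_ginv_skew // oppmxE mxE mxE.
under eq_bigr do rewrite -sumrN.
rewrite exchange_big; apply: eq_bigr => l _.
rewrite /= sumrN ricciE mxE mulr_sumr; congr (- _).
by apply: eq_bigr => m _; rewrite mulrC Hs.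
Qed.

Lemma pdmx_raised_curv k x : Omega x ->
  pdmx k (fun y => raised_trace (H y) (fun a b => curv a b y)) x =
  \matrix_(c, b) \sum_m
     (pdmx k (curv m b) x *m H x + curv m b x *m pdmx k H x) c m.
Proof.
move=> Ox; apply/matrixP => c b; rewrite !mxE.
have sM m : smooth_mx (fun y => curv m b y *m H y).
  by apply: smooth_mxM => //; [exact: smooth_curv | exact: smooth_ginv].
transitivity (pd k (fun y => \sum_m (curv m b y *m H y) c m) x).
  by apply: (pd_ext openO) Ox => y _; rewrite mxE.
rewrite (pd_sum openO) //; last by move=> m; exact: sM.
apply: eq_bigr => m _; rewrite -(pdmxM openO) //; [|exact: smooth_curv|exact: smooth_ginv].
by rewrite mxE.
Qed.

Lemma double_contraction (P Q : 'M[R]_4) : Q^T = Q ->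
  \sum_m \sum_n Q m n * P m n = \tr (Q *m P).
Proof.
move=> Qs; rewrite exchange_big; apply: eq_bigr => m _; rewrite mxE.
by apply: eq_bigr => n _; rewrite -{1}Qs mxE.
Qed.

Lemma ricci_scalarE x : Omega x -> ricci_scalar g x = \tr (H x *m ricci g x).
Proof. by move=> Ox; apply: double_contraction; exact: ginv_sym. Qed.

(** * Covariant derivatives and divergences in matrix form *)

Definition nab k (T : tensor2 R) x : 'M[R]_4 :=
  cov_form2 (fun k => conn k x) k (pdmx k T x) (T x).

(** The argument is any family of matrices in the role of $\nabla_l T$, so that linearity is pure
    algebra at a point. *)
Definition hdiv x (N : 'I_4 -> 'M[R]_4) n : R := \sum_l (H x *m N l) l n.

Lemma nabla_tensor2E T k a b x : nabla_tensor2 g T k a b x = nab k T x a b.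
Proof.
rewrite /nabla_tensor2 /nab /cov_form2 !(addmxE, oppmxE) ![(_ *m _) a b]mxE.
rewrite [pdmx _ _ _ _ _]mxE; congr (_ - _ - _); apply: eq_bigr => l _.
  by rewrite !mxE.
by rewrite mxE mulrC.
Qed.

Lemma divergenceE T n x : divergence g T n x = hdiv x (fun l => nab l T x) n.
Proof.
apply: eq_bigr => l _; rewrite mxE; apply: eq_bigr => m _.
by rewrite nabla_tensor2E.
Qed.

Lemma pd_ginv_trace k T x : smooth_mx T -> Omega x ->
  pd k (fun y => \tr (H y *m T y)) x = \tr (H x *m nab k T x).
Proof.
move=> sT Ox; have sH := smooth_ginv.
rewrite (pd_trace openO) //; last exact: smooth_mxM.
by rewrite (pdmxM openO) // pdmx_ginv // trace_covariant.
Qed.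

Lemma pd_ricci_scalar n x : Omega x ->
  pd n (ricci_scalar g) x = hdiv x (fun l => nab l (ricci g) x) n *+ 2.
Proof.
move=> Ox; rewrite (pd_ext openO n ricci_scalarE Ox).
rewrite pd_ginv_trace //; last exact: smooth_ricci.
have E k : nab k (ricci g) x = cov_form2 (fun k => conn k x) k
    (trace_curv (fun a b => pdmx k (curv a b) x))
    (trace_curv (fun a b => curv a b x)).
  by rewrite /nab pdmx_ricci // -ricciE.
rewrite /hdiv E; under eq_bigr do rewrite E.
(* The last argument, [dS], is the actual derivative of the raised trace, so both descriptions of it
   come from the product rule. *)
apply: (@contracted_bianchi _ _ (fun k => conn k x) (fun a b => curv a b x)
  (fun k a b => pdmx k (curv a b) x) (H x) (fun k => pdmx k H x) _ _ _ _ n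
  (fun k => pdmx k (fun y => raised_trace (H y) (fun a b => curv a b y)) x)).
- by move=> a b; exact: curv_anti.
- by move=> k a b; exact: pdmx_curv_anti.
- exact: ginv_sym.
- by move=> k; exact: pdmx_ginv.
- move=> k a c; apply: cov_curv_cyclic.
  + by move=> *; apply: conn_sym.
  + by move=> *; exact: curv_anti.
  + rewrite !pdmx_curvE // !curvE; apply: bianchi_matrix;
      exact: (pdmx_comm openO _ _ (smooth_conn _) Ox).
- by move=> k; exact: pdmx_raised_curv.
- by rewrite raised_curvE // -ricciE.
- move=> k; rewrite (pdmx_ext openO k raised_curvE) //.
  rewrite (pdmxN openO) //; last first.
    by apply: smooth_mxM => //; [exact: smooth_ginv | exact: smooth_ricci].
  rewrite (pdmxM openO) //; [|exact: smooth_ginv | exact: smooth_ricci].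
  by rewrite -ricciE pdmx_ricci.
Qed.

Lemma nabD k (T T' : tensor2 R) x : smooth_mx T -> smooth_mx T' -> Omega x ->
  nab k (fun y => T y + T' y) x = nab k T x + nab k T' x.
Proof.
move=> sT sT' Ox; rewrite /nab /cov_form2 (pdmxD openO) // mulmxDl mulmxDr.
by rewrite !opprD (addrACA (pdmx k T x)) [LHS]addrACA.
Qed.

Lemma nabZ k s (T : tensor2 R) x : smooth s -> smooth_mx T -> Omega x ->
  nab k (fun y => s y *: T y) x = pd k s x *: T x + s x *: nab k T x.
Proof.
move=> ss sT Ox; rewrite /nab /cov_form2 (pdmxZ openO) //.
by rewrite -scalemxAr -scalemxAl !scalerBr !addrA.
Qed.

Lemma nab_metric k x : Omega x -> nab k g x = 0.
Proof.
by move=> Ox; rewrite /nab /cov_form2 pdmx_metric // -addrA -opprD subrr.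
Qed.

Definition nab_row k (v : V -> 'rV[R]_4) x : 'rV[R]_4 :=
  pdmx k v x - v x *m conn k x.

Lemma nab_outer k (v w : V -> 'rV[R]_4) x :
  smooth_mx v -> smooth_mx w -> Omega x ->
  nab k (fun y => (v y)^T *m w y) x =
  (nab_row k v x)^T *m w x + (v x)^T *m nab_row k w x.
Proof.
move=> sv sw Ox; rewrite /nab /cov_form2 /nab_row.
rewrite (pdmxM openO) //; last exact: smooth_mxT.
rewrite (pdmxT openO) // trmxD trmxN trmx_mul mulmxDl mulmxDr mulNmx mulmxN.
by rewrite !mulmxA !addrA; congr (_ - _); rewrite addrAC.
Qed.

(** * Gradients, Hessians and the Ricci identity *)

Definition grad (h : scalar_field R) x : 'rV[R]_4 := \row_n pd n h x.

Lemma smooth_grad h : smooth h -> smooth_mx (grad h).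
Proof.
move=> sh i j; apply: smooth_ext (smooth_pd j sh) => // x _; by rewrite mxE.
Qed.

Lemma smooth_nab_row k v : smooth_mx v -> smooth_mx (nab_row k v).
Proof.
move=> sv; apply: smooth_mxB => //; first exact: smooth_pdmx.
by apply: smooth_mxM => //; exact: smooth_conn.
Qed.

Lemma hessianE h m n x : hessian g h x m n = nab_row m (grad h) x ord0 n.
Proof.
rewrite !mxE /nabla_covector; congr (_ - _).
  by congr (pd m _ x); apply/funext => y; rewrite mxE.
by apply: eq_bigr => l _; rewrite !mxE mulrC.
Qed.

Lemma smooth_hessian h : smooth h -> smooth_mx (hessian g h).
Proof.
move=> sh i j; apply: smooth_ext (smooth_nab_row i (smooth_grad sh) ord0 j) => //.
by move=> x _; rewrite hessianE.
Qed.

Lemma hessian_sym h x : smooth h -> Omega x -> (hessian g h x)^T = hessian g h x.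
Proof.
move=> sh Ox; apply/matrixP => m n; rewrite [LHS]mxE [LHS]mxE [RHS]mxE.
rewrite /nabla_covector (pd_comm openO n m sh Ox); congr (_ - _).
apply: eq_bigr => l _; congr (_ * _).
by have := conn_sym n l m Ox; rewrite !mxE.
Qed.

Lemma boxE h x : Omega x -> box g h x = \tr (H x *m hessian g h x).
Proof. by move=> Ox; apply: double_contraction; exact: ginv_sym. Qed.

Lemma smooth_box h : smooth h -> smooth (box g h).
Proof.
move=> sh; apply: (@smooth_ext _ _ openO (fun x => \tr (H x *m hessian g h x))).
  by move=> x Ox; rewrite boxE.
apply: smooth_trace => //; apply: smooth_mxM => //; first exact: smooth_ginv.
exact: smooth_hessian.
Qed.

Lemma ricci_identity h k l x : smooth h -> Omega x ->
  pdmx k (nab_row l (grad h)) x - nab_row l (grad h) x *m conn k x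
  - (pdmx l (nab_row k (grad h)) x - nab_row k (grad h) x *m conn l x)
  = - (grad h x *m curv k l x).
Proof.
move=> sh Ox; have sg := smooth_grad sh; have sc := smooth_conn.
have E a b : pdmx a (nab_row b (grad h)) x = pdmx a (pdmx b (grad h)) x -
   (pdmx a (grad h) x *m conn b x + grad h x *m pdmx a (conn b) x).
  rewrite (pdmxB openO) //; [|exact: smooth_pdmx|exact: smooth_mxM].
  by rewrite (pdmxM openO).
rewrite !E (pdmx_comm openO k l sg Ox) curvE /nab_row.
exact: ricci_identity_matrix.
Qed.

(** The full covariant derivative adds to [ricci_identity] a correction for the inner derivative
    index; by [conn_sym] it is symmetric in $k,l$ and drops out. *)
Lemma nab_hessian_comm h k l m x : smooth h -> Omega x ->
  nab k (hessian g h) x l m - nab l (hessian g h) x k m =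
  - (grad h x *m curv k l x) ord0 m.
Proof.
move=> sh Ox; have E a b : nab a (hessian g h) x b m =
    (pdmx a (nab_row b (grad h)) x - nab_row b (grad h) x *m conn a x) ord0 m
    - \sum_c conn a x c b * hessian g h x c m.
  rewrite /nab /cov_form2 !(addmxE, oppmxE) addrAC; congr (_ - _ - _).
  - rewrite [LHS]mxE [RHS]mxE; congr (pd a _ x).
    by apply/funext => y; rewrite hessianE.
  - by rewrite [LHS]mxE [RHS]mxE; apply: eq_bigr => c _; rewrite hessianE.
  - by rewrite mxE; apply: eq_bigr => c _; rewrite [(conn a x)^T _ _]mxE.
rewrite !E -oppmxE -(ricci_identity k l sh Ox) [in RHS]addmxE [in RHS]oppmxE.
have -> : \sum_c conn k x c l * hessian g h x c m =
    \sum_c conn l x c k * hessian g h x c m.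
  by apply: eq_bigr => c _; rewrite conn_sym.
by rewrite opprB addrA subrK.
Qed.

Lemma nab_sym k T x : (forall y, Omega y -> (T y)^T = T y) -> Omega x ->
  (nab k T x)^T = nab k T x.
Proof.
move=> Ts Ox; rewrite /nab /cov_form2 !(trmxD, trmxN, trmx_mul) trmxK Ts //.
by rewrite -(pdmxT openO) // (pdmx_ext openO k Ts Ox) addrAC.
Qed.

Lemma hdiv_hessian h n x : smooth h -> Omega x ->
  hdiv x (fun l => nab l (hessian g h) x) n =
  pd n (box g h) x + (grad h x *m (H x *m ricci g x)) ord0 n.
Proof.
move=> sh Ox; have sH := smooth_hessian sh.
have Hs i j : H x i j = H x j i by rewrite -{1}(ginv_sym Ox) mxE.
have Ns l i j : nab l (hessian g h) x i j = nab l (hessian g h) x j i.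
  by rewrite -{1}(nab_sym l (fun y => hessian_sym sh) Ox) mxE.
rewrite (pd_ext openO n (boxE h) Ox) pd_ginv_trace //.
rewrite -[H x *m ricci g x]opprK -raised_curvE // mulmxN oppmxE mxE.
(* Symmetry of the Hessian brings $n$ next to the derivative index $l$; exchanging them leaves the
   trace $\partial_n\Box h$ and a curvature term. *)
transitivity (\sum_l \sum_m H x l m * (nab n (hessian g h) x l m
    - (grad h x *m curv l n x) ord0 m)).
  apply: eq_bigr => l _; rewrite mxE; apply: eq_bigr => m _; congr (_ * _).
  have /eqP := nab_hessian_comm l n m sh Ox; rewrite subr_eq => /eqP E.
  exact: etrans (Ns l m n) (etrans E (addrC _ _)).
rewrite -double_contraction ?ginv_sym //.
transitivity (\sum_l (\sum_m H x l m * nab n (hessian g h) x l m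
    - \sum_m H x l m * (grad h x *m curv l n x) ord0 m)).
  by apply: eq_bigr => l _; rewrite -sumrB; apply: eq_bigr => m _; rewrite mulrBr.
rewrite sumrB; congr (_ - _).
transitivity (\sum_c \sum_l grad h x ord0 c * (curv l n x *m H x) c l); last first.
  by apply: eq_bigr => c _; rewrite [raised_trace _ _ _ _]mxE mulr_sumr.
rewrite [RHS]exchange_big; apply: eq_bigr => l _.
transitivity ((grad h x *m (curv l n x *m H x)) ord0 l); last by rewrite mxE.
by rewrite mulmxA [RHS]mxE; apply: eq_bigr => m _; rewrite mulrC Hs.
Qed.

(** * Divergences of the terms of the field equations *)

Lemma hdivD x N N' n :
  hdiv x (fun l => N l + N' l) n = hdiv x N n + hdiv x N' n.
Proof. by rewrite -big_split; apply: eq_bigr => l _; rewrite mulmxDr mxE. Qed.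

Lemma hdivZ x (s : R) N n : hdiv x (fun l => s *: N l) n = s * hdiv x N n.
Proof. by rewrite mulr_sumr; apply: eq_bigr => l _; rewrite -scalemxAr mxE. Qed.

Lemma hdiv_grad x s (M : 'M[R]_4) n :
  hdiv x (fun l => pd l s x *: M) n = (grad s x *m (H x *m M)) ord0 n.
Proof.
by rewrite mxE; apply: eq_bigr => l _; rewrite -scalemxAr [LHS]mxE [grad _ _ _ _]mxE.
Qed.

Lemma hdiv_outer h h' n x : smooth h -> smooth h' -> Omega x ->
  hdiv x (fun l => nab l (fun y => (grad h y)^T *m grad h' y) x) n =
  box g h x * pd n h' x
  + (grad h x *m H x *m hessian g h' x) ord0 n.
Proof.
move=> sh sh' Ox.
transitivity (\sum_l ((H x *m (nab_row l (grad h) x)^T) l ord0 * pd n h' x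
   + (grad h x *m H x) ord0 l * hessian g h' x l n)).
  apply: eq_bigr => l _; rewrite nab_outer //; try exact: smooth_grad.
  rewrite mulmxDr !mulmxA addmxE; congr (_ + _).
    by rewrite mxE big_ord1 [grad _ _ _ _]mxE.
  rewrite mxE big_ord1 hessianE; congr (_ * _).
  by rewrite -[H x in LHS](ginv_sym Ox) -trmx_mul mxE.
rewrite big_split /= -mulr_suml; congr (_ * _ + _); last by rewrite mxE.
rewrite boxE //; apply: eq_bigr => l _; rewrite [LHS]mxE [RHS]mxE.
apply: eq_bigr => m _; rewrite [X in _ * X]mxE -hessianE.
by rewrite -{1}(hessian_sym sh Ox) [X in _ * X]mxE.
Qed.

Definition grad_dot h h' x : R := (grad h x *m H x *m (grad h' x)^T) ord0 ord0.

Lemma smooth_grad_dot h h' : smooth h -> smooth h' -> smooth (grad_dot h h').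
Proof.
move=> sh sh'; have sg := smooth_grad sh; have sg' := smooth_grad sh'.
have : smooth_mx (fun x => grad h x *m H x *m (grad h' x)^T).
  apply: smooth_mxM => //; last exact: smooth_mxT.
  by apply: smooth_mxM => //; exact: smooth_ginv.
exact.
Qed.

Lemma pd_grad_dot h h' n x : smooth h -> smooth h' -> Omega x ->
  pd n (grad_dot h h') x =
  (grad h' x *m H x *m hessian g h x) ord0 n
  + (grad h x *m H x *m hessian g h' x) ord0 n.
Proof.
move=> sh sh' Ox; have sg := smooth_grad sh; have sg' := smooth_grad sh'.
have sH := smooth_ginv.
transitivity (pdmx n (fun y => grad h y *m H y *m (grad h' y)^T) x ord0 ord0).
  by rewrite mxE.
rewrite !(pdmxM openO) //; [|exact: smooth_mxM|exact: smooth_mxT].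
rewrite (pdmxT openO) // pdmx_ginv // grad_dot_matrix addmxE.
have rowE f : smooth f ->
    pdmx n (grad f) x - grad f x *m conn n x = row n (hessian g f x).
  by move=> sf; apply/rowP => j; rewrite [RHS]mxE hessianE.
have entryE (M : 'rV[R]_4) f : smooth f ->
    (M *m (row n (hessian g f x))^T) ord0 ord0 = (M *m hessian g f x) ord0 n.
  move=> sf; rewrite [LHS]mxE [RHS]mxE; apply: eq_bigr => l _; congr (_ * _).
  by rewrite -[in RHS](hessian_sym sf Ox) 2!mxE [RHS]mxE.
have E : (row n (hessian g h x) *m H x *m (grad h' x)^T) ord0 ord0 =
    (grad h' x *m H x *m hessian g h x) ord0 n.
  by rewrite -[LHS]trmx11 !trmx_mul trmxK ginv_sym // mulmxA entryE.
apply: etrans _ (congr2 +%R E (entryE _ _ sh')).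
apply: (congr2 +%R).
  exact: (congr1 (fun a : 'rV[R]_4 => (a *m H x *m (grad h' x)^T) ord0 ord0)
    (rowE _ sh)).
exact: (congr1 (fun a : 'rV[R]_4 => (grad h x *m H x *m a^T) ord0 ord0)
  (rowE _ sh')).
Qed.

Lemma hdiv_ricci x s n : Omega x ->
  hdiv x (fun l => pd l s x *: einstein g x) n =
  (grad s x *m (H x *m ricci g x)) ord0 n - 2^-1 * ricci_scalar g x * pd n s x.
Proof.
move=> Ox; rewrite hdiv_grad /einstein mulmxBr -scalemxAr (ginvK Ox) mulmxBr.
rewrite addmxE oppmxE -scalemxAr mulmx1; congr (_ - _).
by rewrite !mxE.
Qed.

Lemma smooth_ricci_scalar : smooth (ricci_scalar g).
Proof.
apply: (@smooth_ext _ _ openO (fun x => \tr (H x *m ricci g x))).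
  by move=> x Ox; rewrite ricci_scalarE.
apply: smooth_trace => //; apply: smooth_mxM => //; first exact: smooth_ginv.
exact: smooth_ricci.
Qed.

Lemma smooth_einstein : smooth_mx (einstein g).
Proof.
apply: smooth_mxB => //; first exact: smooth_ricci.
apply: smooth_mxZ => //; last exact: smooth_metric.
by apply: smoothM => //; [exact: smooth_cst | exact: smooth_ricci_scalar].
Qed.

Lemma hdiv_scaled s (T : tensor2 R) n x : smooth s -> smooth_mx T -> Omega x ->
  hdiv x (fun l => nab l (fun y => s y *: T y) x) n =
  (grad s x *m (H x *m T x)) ord0 n + s x * hdiv x (fun l => nab l T x) n.
Proof.
move=> ss sT Ox; rewrite -hdiv_grad -hdivZ -hdivD.
by apply: eq_bigr => l _; rewrite nabZ.
Qed.

Lemma hdiv_scaled_metric s n x : smooth s -> Omega x ->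
  hdiv x (fun l => nab l (fun y => s y *: g y) x) n = pd n s x.
Proof.
move=> ss Ox; rewrite hdiv_scaled //; last exact: smooth_metric.
rewrite ginvK // mulmx1 [grad _ _ _ _]mxE.
by rewrite /hdiv big1 ?mulr0 ?addr0 // => l _; rewrite nab_metric // mulmx0 mxE.
Qed.

Lemma hdiv_einstein n x : Omega x ->
  hdiv x (fun l => nab l (einstein g) x) n = 0.
Proof.
move=> Ox; have sR := smooth_ricci_scalar.
have s2 : smooth (fun x => - (2^-1 * ricci_scalar g x)).
  by apply: smoothN => //; apply: smoothM => //; exact: smooth_cst.
have E : forall y, Omega y -> einstein g y =
    ricci g y + - (2^-1 * ricci_scalar g y) *: g y.
  by move=> y _; rewrite /einstein scaleNr.
transitivity (hdiv x (fun l => nab l (fun y => ricci g y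
    + - (2^-1 * ricci_scalar g y) *: g y) x) n).
  apply: eq_bigr => l _; congr ((_ *m _) l n).
  by rewrite /nab (pdmx_ext openO l E Ox) E.
transitivity (hdiv x (fun l => nab l (ricci g) x) n
    + hdiv x (fun l => nab l (fun y => - (2^-1 * ricci_scalar g y) *: g y) x) n).
  rewrite -hdivD; apply: eq_bigr => l _; rewrite nabD //; first exact: smooth_ricci.
  by apply: smooth_mxZ => //; exact: smooth_metric.
have E2 : pd n (fun y => - (2^-1 * ricci_scalar g y)) x =
    - hdiv x (fun l => nab l (ricci g) x) n.
  transitivity (pd n (fun y => (- 2^-1) * ricci_scalar g y) x).
    by apply: (pd_ext openO) Ox => y _; rewrite mulNr.
  rewrite (pdM n (smooth_cst _) sR Ox) pd_cst mul0r addr0 pd_ricci_scalar //.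
  by rewrite mulNr -[hdiv _ _ _ *+ 2]mulr_natl mulKf ?pnatr_eq0.
by rewrite (hdiv_scaled_metric n s2 Ox) E2 subrr.
Qed.

Lemma nab_ext k (T T' : tensor2 R) x : (forall y, Omega y -> T y = T' y) ->
  Omega x -> nab k T x = nab k T' x.
Proof. by move=> E Ox; rewrite /nab (pdmx_ext openO k E Ox) E. Qed.

Lemma divergence_ext (T T' : tensor2 R) n x :
  (forall y, Omega y -> T y = T' y) -> Omega x ->
  divergence g T n x = divergence g T' n x.
Proof.
move=> E Ox; rewrite !divergenceE; apply: eq_bigr => l _.
by rewrite (nab_ext l E Ox).
Qed.

Lemma divergenceD (T T' : tensor2 R) n x :
  smooth_mx T -> smooth_mx T' -> Omega x ->
  divergence g (fun y => T y + T' y) n x = divergence g T n x + divergence g T' n x.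
Proof.
move=> sT sT' Ox; rewrite !divergenceE -hdivD; apply: eq_bigr => l _.
by rewrite nabD.
Qed.

Lemma divergenceZ (c : R) (T : tensor2 R) n x : smooth_mx T -> Omega x ->
  divergence g (fun y => c *: T y) n x = c * divergence g T n x.
Proof.
move=> sT Ox; rewrite !divergenceE -hdivZ; apply: eq_bigr => l _.
by rewrite (nabZ l (smooth_cst c) sT Ox) pd_cst scale0r add0r.
Qed.

Lemma divergence_einstein_scaled s n x : smooth s -> Omega x ->
  divergence g (fun y => s y *: einstein g y) n x =
  (grad s x *m (H x *m ricci g x)) ord0 n - 2^-1 * ricci_scalar g x * pd n s x.
Proof.
move=> ss Ox; rewrite divergenceE hdiv_scaled //; last exact: smooth_einstein.
by rewrite hdiv_einstein // mulr0 addr0 -hdiv_grad hdiv_ricci.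
Qed.

Lemma divergence_scaled_metric s n x : smooth s -> Omega x ->
  divergence g (fun y => s y *: g y) n x = pd n s x.
Proof. by move=> ss Ox; rewrite divergenceE hdiv_scaled_metric. Qed.

(** The polarization of the stress tensor $\partial_m h\,\partial_n h-\frac12 g_{mn}(\nabla h)^2$ of
    a massless scalar field. *)
Definition stress h h' : tensor2 R := fun x =>
  2^-1 *: ((grad h x)^T *m grad h' x + (grad h' x)^T *m grad h x
           + - grad_dot h h' x *: g x).

Lemma smooth_outer h h' : smooth h -> smooth h' ->
  smooth_mx (fun y => (grad h y)^T *m grad h' y).
Proof.
move=> sh sh'; apply: smooth_mxM => //; last exact: smooth_grad.
by apply: smooth_mxT => //; exact: smooth_grad.
Qed.

Lemma divergence_outer h h' n x : smooth h -> smooth h' -> Omega x ->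
  divergence g (fun y => (grad h y)^T *m grad h' y) n x =
  box g h x * pd n h' x + (grad h x *m H x *m hessian g h' x) ord0 n.
Proof. by move=> *; rewrite divergenceE hdiv_outer. Qed.

Lemma smooth_stress_trace h h' : smooth h -> smooth h' ->
  smooth_mx (fun y => - grad_dot h h' y *: g y).
Proof.
move=> sh sh'; apply: smooth_mxZ => //; last exact: smooth_metric.
by apply: smoothN => //; exact: smooth_grad_dot.
Qed.

Lemma smooth_stress h h' : smooth h -> smooth h' -> smooth_mx (stress h h').
Proof.
move=> sh sh'; apply: smooth_mxZ => //; first exact: smooth_cst.
have := smooth_outer; have := smooth_stress_trace sh sh' => s1 s2.
by apply: smooth_mxD => //; apply: smooth_mxD => //; exact: s2.
Qed.

(** The gradients contracted with Hessians from the two outer products are exactly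
    $\partial_n\langle\nabla h,\nabla h'\rangle$, which the metric term subtracts. *)
Lemma divergence_stress h h' n x : smooth h -> smooth h' -> Omega x ->
  divergence g (stress h h') n x =
  2^-1 * (box g h x * pd n h' x + box g h' x * pd n h x).
Proof.
move=> sh sh' Ox; have s1 := smooth_outer; have s2 := smooth_stress_trace sh sh'.
have s3 : smooth_mx (fun y => (grad h y)^T *m grad h' y + (grad h' y)^T *m grad h y).
  by apply: smooth_mxD => //; exact: s1.
rewrite divergenceZ //; last exact: smooth_mxD.
congr (_ * _); rewrite divergenceD // divergenceD //; try exact: s1.
rewrite !divergence_outer // divergence_scaled_metric //; last first.
  by apply: smoothN => //; exact: smooth_grad_dot.
have E : pd n (fun y => - grad_dot h h' y) x = - pd n (grad_dot h h') x.
  transitivity (pd n (fun y => -1 * grad_dot h h' y) x).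
    by apply: (pd_ext openO) Ox => y _; rewrite mulN1r.
  by rewrite (pdM n (smooth_cst _) (smooth_grad_dot sh sh') Ox) pd_cst mul0r
    addr0 mulN1r.
rewrite E (pd_grad_dot n sh sh' Ox).
exact: stress_arith.
Qed.

Lemma divergence_hessian h n x : smooth h -> Omega x ->
  divergence g (hessian g h) n x =
  pd n (box g h) x + (grad h x *m (H x *m ricci g x)) ord0 n.
Proof. by move=> sh Ox; rewrite divergenceE hdiv_hessian. Qed.

(** * From index notation to matrices, and the final balance *)

Lemma sum_delta (F : 'I_4 -> R) m : \sum_s (m == s)%:R * F s = F m.
Proof.
rewrite (bigD1 m) //= eqxx mul1r big1 ?addr0 // => s /negPf.
by rewrite eq_sym => ->; rewrite mul0r.
Qed.

Lemma sum_sym_delta (u v : 'I_4 -> R) m n :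
  \sum_s \sum_l sym_delta R m n s l * u s * v l = 2^-1 * (u m * v n + v m * u n).
Proof.
transitivity (\sum_s (m == s)%:R * (\sum_l (n == l)%:R * (2^-1 * (u s * v l)))
  + \sum_s (n == s)%:R * (\sum_l (m == l)%:R * (2^-1 * (u s * v l)))).
  rewrite -big_split; apply: eq_bigr => s _ /=; rewrite !mulr_sumr -big_split.
  by apply: eq_bigr => l _; rewrite /sym_delta /=; ring.
by rewrite !sum_delta; ring.
Qed.

Lemma stressE h h' m n x : stress h h' x m n =
  \sum_s \sum_l (sym_delta R m n s l - 2^-1 * g x m n * H x s l)
    * pd s h x * pd l h' x.
Proof.
transitivity (\sum_s \sum_l sym_delta R m n s l * pd s h x * pd l h' x
  - 2^-1 * (g x m n * \sum_s \sum_l H x s l * pd s h x * pd l h' x)).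
  rewrite (sum_sym_delta (fun s => pd s h x) (fun s => pd s h' x)).
  have -> : \sum_s \sum_l H x s l * pd s h x * pd l h' x = grad_dot h h' x.
    rewrite /grad_dot mxE exchange_big; apply: eq_bigr => l _.
    rewrite [X in X * _]mxE mulr_suml; apply: eq_bigr => s _.
    by rewrite !mxE [X in X * _]mulrC.
  rewrite mxE addmxE addmxE mxE big_ord1 [X in _ + X + _]mxE big_ord1.
  rewrite [X in _ + _ + X]mxE !mxE.
  by rewrite mulNr mulrBr [grad_dot _ _ _ * _]mulrC.
rewrite !mulr_sumr -sumrB; apply: eq_bigr => s _.
rewrite !mulr_sumr -sumrB; apply: eq_bigr => l _.
exact: split_term.
Qed.

Lemma divergence_nonlocal (f : R -> R) (U : set R) X Y h n x :
  analytic_on U f -> smooth X -> smooth Y -> (forall y, Omega y -> U (X y)) ->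
  Omega x -> box g X x = ricci_scalar g x ->
  box g Y x = ricci_scalar g x * derive1 f (X x) ->
  (forall y, Omega y -> h y = f (X y) + Y y) ->
  divergence g (fun y => einstein g y + (h y *: einstein g y
    + box g h y *: g y - hessian g h y + stress Y X y)) n x = 0.
Proof.
move=> fU sX sY XU Ox boxX boxY hE.
have sf : smooth (fun y => f (X y)) := smooth_comp openO sX fU XU.
have sh : smooth h.
  by apply: smooth_ext (smoothD openO sf sY) => // y Oy; rewrite hE.
have sh1 : smooth (fun y => 1 + h y) := smoothD openO (smooth_cst 1) sh.
have dh k : pd k h x = derive1 f (X x) * pd k X x + pd k Y x.
  rewrite (pd_ext openO k hE Ox) (pdD k sf sY Ox) pd_comp //.
    exact: smooth_differentiable Ox.
  by have [df _] := analytic_on_derive fU; exact/df/XU.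
have dh1 k : pd k (fun y => 1 + h y) x = pd k h x.
  by rewrite (pdD k (smooth_cst 1) sh Ox) pd_cst add0r.
have sE := smooth_einstein; have sHs := smooth_hessian sh.
have sB := smooth_box sh; have sS := smooth_stress sY sX.
have sg := smooth_metric.
(* Collecting $G+hG$ as $(1+h)G$ makes every summand a scalar multiple of a tensor or a [stress],
   with known divergence. *)
rewrite (divergence_ext (T' := fun y => (1 + h y) *: einstein g y +
  (box g h y *: g y + (-1 *: hessian g h y + stress Y X y)))) //; last first.
  by move=> y _; rewrite scalerDl scale1r scaleN1r !addrA.
have sN : smooth_mx (fun y => -1 *: hessian g h y).
  by apply: smooth_mxZ => //; exact: smooth_cst.
have sZ : smooth_mx (fun y => (1 + h y) *: einstein g y) by exact: smooth_mxZ.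
have sZg : smooth_mx (fun y => box g h y *: g y) by exact: smooth_mxZ.
have sNS := smooth_mxD openO sN sS.
rewrite (divergenceD n sZ (smooth_mxD openO sZg sNS) Ox).
rewrite (divergenceD n sZg sNS Ox) (divergenceD n sN sS Ox).
rewrite (divergence_einstein_scaled n sh1 Ox) (divergence_scaled_metric n sB Ox).
rewrite (divergenceZ (-1) n sHs Ox) (divergence_hessian n sh Ox).
rewrite (divergence_stress n sY sX Ox) boxX boxY dh1 dh.
have -> : grad (fun y => 1 + h y) x = grad h x.
  by apply/rowP => k; rewrite !mxE dh1.
exact: field_equation_arith.
Qed.
End Geometry.

Theorem theorem4p1 (R : realType)
    (Omega : set 'rV[R]_4) (hO : open Omega)
    (g : tensor2 R) (hg : lorentzian_metric Omega g)
    (G : 'rV[R]_4 -> scalar_field R -> R)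
    (hG : retarded_green_function Omega g G)
    (src fld : set (scalar_field R)) (hinv : inverse_of_box Omega g G src fld)
    (U : set R) (hU : open U) (f : R -> R) (hf : analytic_on U f)
    (hR : src (ricci_scalar g))
    (hfU : forall x, Omega x -> U (boxinv Omega g G (ricci_scalar g) x))
    (hRf : src (fun x => ricci_scalar g x
                         * derive1 f (boxinv Omega g G (ricci_scalar g) x))) :
  forall (x : 'rV[R]_4) (n : 'I_4), Omega x ->
    divergence g
      (fun y => einstein g y + Delta_einstein g (boxinv Omega g G) f y)
      n x = 0.
Proof.
move=> x n Ox; have [_ fldS [srcF _] boxK _] := hinv.
set X := boxinv Omega g G (ricci_scalar g) in hfU hRf *.
set Y := boxinv Omega g G (fun x => ricci_scalar g x * derive1 f (X x)).
(* [boxinv] sends [src] into [fld], whose members are smooth on [Omega]. *)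
have sX : smooth_on Omega X := fldS _ (srcF _ hR).
have sY : smooth_on Omega Y := fldS _ (srcF _ hRf).
(* The entrywise definition becomes a matrix expression; in [stress] the field $Y$ comes first,
   matching $\partial_\sigma Y\,\partial_\lambda X$. *)
transitivity (divergence g (fun y => einstein g y +
  ((f (X y) + Y y) *: einstein g y
    + box g (fun x => f (X x) + Y x) y *: g y
    - hessian g (fun x => f (X x) + Y x) y + stress g Y X y)) n x).
  apply: (divergence_ext hO) Ox => y Oy; congr (_ + _); apply/matrixP => m k.
  have E (A B C D : 'M[R]_4) :
      (A + B - C + D) m k = A m k + B m k - C m k + D m k.
    by rewrite !(addmxE, oppmxE).
  rewrite [LHS]mxE [RHS]E stressE; congr (_ + _ - _ + _).
    by rewrite [RHS]mxE [RHS]mulrC.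
  by rewrite [RHS]mxE [RHS]mulrC.
exact: (divergence_nonlocal hO hg n hf sX sY hfU Ox (boxK _ hR x Ox)
  (boxK _ hRf x Ox) (fun _ _ => erefl)).
Qed.
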